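(* Let $K \subset \mathbb{C}$ be a number field with ring of integers $\mathcal{O}_K$, and let $\beta \in \mathcal{O}_K$ be a real algebraic integer with $\beta > 1$ and $|N(\beta)| > 1$. Let $f(X) \in \mathcal{O}_K[X]$ be a polynomial whose complex roots are exactly three pairwise distinct numbers $z_1, z_2, z_3$, where $z_1$ is real with $z_1 > 1$, $|z_2| \leq 1$ and $|z_3| \leq 1$. Let $A_1, A_2, A_3 \in \mathbb{C}$ be algebraic numbers. If $A_1 \neq 0$ and $z_1 \notin K$, then there are only finitely many tuples $$(l,m,n,d_1,d_2) \in \mathbb{Z}_{\geq 1}^3 \times \{1,\dots,|N(\beta)|-1\} \times \{0,1,\dots,|N(\beta)|-1\}$$ satisfying $$A_1 z_1^n + A_2 z_2^n + A_3 z_3^n = d_1 \sum_{i=l+m}^{2l+m-1} \beta^i + d_2 \sum_{i=l}^{l+m-1} \beta^i + d_1 \sum_{i=0}^{l-1} \beta^i .$$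
   Context: $N(\beta)$ denotes the norm $N_{K/\mathbb{Q}}(\beta)$, which is a rational integer. *)

(* Defs.v *)
From HB Require Import structures.
From mathcomp Require Export all_boot all_order all_algebra all_field.
From mathcomp Require Export complex.
From mathcomp Require Export boolp classical_sets cardinality reals.

Set Implicit Arguments.
Unset Strict Implicit.
Unset Printing Implicit Defensive.

Import GRing.Theory.
Local Open Scope ring_scope.

Definition algebraic_integer (K : fieldExtType rat) (x : K) : Prop :=
  integralOver (intr : int -> K) x.

(* N_{L/F}(x) is the determinant of the F-linear map y |-> y * x on L; its
   value does not depend on the chosen basis. *)
Definition field_norm (F : fieldType) (L : fieldExtType F) (x : L) : F :=
  \det (passmx.mxof (vbasis {:L}) (vbasis {:L}) (amulr x)).

(* Main.v *)
Require Import Defs.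
From mathcomp Require Import perm all_analysis.
From mathcomp Require Import ring lra zify.

(**
  Multiplying by [beta - 1] turns the equation into
  [A1 z1^n (beta - 1) = d1 beta^(2l+m) - e beta^(l+m) + e beta^l - d1 + O(1)] with
  [e = d1 - d2].  Its leading term makes
  [ln (d1 / (A1 (beta - 1))) - n ln z1 + (2l+m) ln beta] of size [beta^-l]; its two leading
  terms make [ln ((d1 beta^l - e) / (A1 (beta - 1))) - n ln z1 + (l+m) ln beta] of size
  [beta^-(l+m)].  A lower bound [exp (- t^60)] for linear forms in three logarithms, where
  [t] bounds the logarithmic heights and the logarithms of the coefficients, gives first
  [l = O(log(n)^60)] and then [2l + m = O(log(n)^3720)], which bounds everything.  Neither
  form vanishes for large [n]: a power [z1^a] in [K] would be a root of [gcd(f, X^a - z1^a)],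
  all of whose roots equal [z1] because the other roots of [f] are not larger than 1 in
  modulus, and then [z1] itself would lie in [K].

  The lower bound is Baker's method with generous parameters.  The pigeonhole principle
  provides small integers [p l], not all zero, such that the sums
  [\sum_l p l u_l^i v_l^j th_l^x] are small, hence zero by Liouville's inequality, for few
  [x] and many [(i, j)]; here [th_l = a1^l1 a2^l2 a3^l3], [u_l = l1 + l3 b1] and
  [v_l = l2 + l3 b2].  When the linear form is tiny these sums are nearly the derivatives of
  exponential sums, so Newton interpolation makes them small, and again zero, for more [x] and
  half as many [(i, j)].  After finitely many rounds all [p l] vanish.
*)

Set Implicit Arguments.
Unset Strict Implicit.
Unset Printing Implicit Defensive.

Import Order.TTheory GRing.Theory Num.Theory.
Local Open Scope ring_scope.

(** * Interpolation of exponential sums *)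

Section PolynomialInterpolation.
Variable R : realFieldType.
Implicit Types (p q : {poly R}) (r x e : R).

(** The [T]-th normalised derivative at [r] of the polynomial with coefficients [|p_k|]; it controls
    the remainder of interpolation at [T] nodes in [[0, r]]. *)
Definition majorant n r T p : R :=
  \sum_(k < n) `|p`_k| * 'C(k, T)%:R * r ^+ (k - T).

Lemma majorant0 n r p : 0 <= r -> (size p <= n)%N ->
  forall x, `|x| <= r -> `|p.[x]| <= majorant n r 0 p.
Proof.
move=> r0 sp x xr; rewrite (horner_coef_wide x sp).
apply: le_trans (ler_norm_sum _ _ _) _; apply: ler_sum => k _.
by rewrite bin0 mulr1 subn0 normrM normrX ler_wpM2l // lerXn2r ?nnegrE.
Qed.

(** Comparing coefficients gives [p_(k+1) = q_k - a q_(k+1)], hence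
    [|p_(k+1)| >= |q_k| - r |q_(k+1)|]; Pascal's rule and an index shift put the majorant of [q] in
    this form. *)
Lemma majorant_quotient n r T p q a c : 0 <= r -> `|a| <= r ->
  (size q <= n)%N -> p = q * ('X - a%:P) + c%:P ->
  majorant n r T q <= majorant n.+1 r T.+1 p.
Proof.
move=> r0 ar sq Ep; rewrite /majorant.
(* [B] is the second term of Pascal's rule; it vanishes at both ends of the range, so its index may
   be shifted by one. *)
pose B k := `|q`_k| * 'C(k, T.+1)%:R * r ^+ (k - T).
have B0 : B 0%N = 0 by rewrite /B bin0n /= mulr0 mul0r.
have Bn : B n = 0 by rewrite /B nth_default // normr0 !mul0r.
have -> : \sum_(k < n) `|q`_k| * 'C(k, T)%:R * r ^+ (k - T) =
  \sum_(k < n) (`|q`_k| * 'C(k.+1, T.+1)%:R * r ^+ (k - T) - B k.+1).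
  rewrite sumrB.
  have -> : \sum_(k < n) B k.+1 = \sum_(k < n) B k.

    have E1 : \sum_(k < n.+1) B k = \sum_(k < n) B k.+1.
      by rewrite big_ord_recl B0 add0r.
    by rewrite -E1 big_ord_recr /= Bn addr0.
  rewrite -sumrB; apply: eq_bigr => k _.
  by rewrite /B binS natrD; ring.
rewrite big_ord_recl bin0n /= mulr0 mul0r add0r; apply: ler_sum => k _.
rewrite /bump leq0n add1n subSS.
have -> : p`_k.+1 = q`_k - a * q`_k.+1.
  by rewrite Ep mulrBr coefD coefB coefC /= addr0 coefMX /= coefMC mulrC.
case: (ltnP k T) => [kT|Tk].
  by rewrite /B bin_small ?mulr0 ?mul0r ?subr0 ?ltnS //.
rewrite /B subSn // exprS.
have -> : `|q`_k| * 'C(k.+1, T.+1)%:R * r ^+ (k - T) -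
   `|q`_k.+1| * 'C(k.+1, T.+1)%:R * (r * r ^+ (k - T)) =
   (`|q`_k| - r * `|q`_k.+1|) * ('C(k.+1, T.+1)%:R * r ^+ (k - T)) by ring.
rewrite -[leRHS]mulrA; apply: ler_wpM2r; first by rewrite mulr_ge0 ?exprn_ge0.
apply: le_trans (lerB_dist _ _); rewrite lerD2l lerN2 normrM.
by rewrite ler_wpM2r.
Qed.

(* Newton interpolation, one node at a time: [p = p.[a] + ('X - a) q], and the
   smallness of the normalised derivatives of [p] at the nodes passes to [q]. *)
Lemma interpolation_bound r T0 (s : seq nat) : 0 <= r ->
  (forall b, b \in s -> b%:R <= r) -> (size s <= T0)%N ->
  forall n p e x, (size p <= n)%N -> 0 <= e ->
  (forall b j, (j < count_mem b s)%N -> `|p^`N(j).[b%:R]| <= e) ->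
  0 <= x <= r ->
  `|p.[x]| <= (1 + T0%:R *+ 2 * r) ^+ size s * e +
              r ^+ size s * majorant n r (size s) p.
Proof.
move=> r0; elim: s => [|a s IH] sr sT n p e x sp e0 H xr.
  rewrite !expr0 !mul1r; apply: ler_wpDl => //; apply: majorant0 => //.
  by case/andP: xr => x0 ?; rewrite ger0_norm.
have ar : a%:R <= r by apply: sr; rewrite mem_head.
have Hpa : `|p.[a%:R]| <= e.
  by have := H a 0%N; rewrite nderivn0 /= eqxx; apply.
have [q Ep] : exists q, p = q * ('X - a%:R%:P) + p.[a%:R]%:P.
  have : root (p - p.[a%:R]%:P) a%:R by rewrite /root !hornerE subrr.
  by case/factor_theorem => q Eq; exists q; rewrite -Eq subrK.
have sq : (size q <= n.-1)%N.
  have [->|q0] := eqVneq q 0; first by rewrite size_poly0.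
  have E : size (q * ('X - a%:R%:P)) = (size q).+1.
    by rewrite size_Mmonic ?monicXsubC // size_XsubC addn2.
  have : (size p = (size q).+1)%N.
    rewrite Ep size_polyDl E // size_polyC.
    by case: (_ != 0) => //; rewrite ltnS size_poly_gt0.
  by move=> E2; move: sp; rewrite E2; case: (n).
have sT' : (size s <= T0)%N by apply: ltnW.
have rec b j : p^`N(j.+1).[b%:R] = q^`N(j).[b%:R] + (b%:R - a%:R) * q^`N(j.+1).[b%:R].
  have -> : p = (q * 'X + p.[a%:R]%:P) - a%:R *: q.
    by rewrite {1}Ep -mul_polyC; ring.
  by rewrite nderivnB nderivnMXaddC nderivnZ !hornerE; ring.
have rec0 b : p.[b%:R] = (b%:R - a%:R) * q.[b%:R] + p.[a%:R].
  by rewrite {1}Ep !hornerE mulrC.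
(* Distinct nodes are integers, so dividing by [b - a] never enlarges a bound. *)
have dist b : b != a -> 1 <= `|b%:R - a%:R : R|.
  move=> ba; have [lt|lt] := ltnP a b.
    by rewrite -natrB 1?ltnW // normr_nat ler1n subn_gt0.
  by rewrite distrC -natrB // normr_nat ler1n subn_gt0 ltn_neqAle ba.
(* At [b = a] the recurrence loses nothing; at the other nodes each derivative order adds one more
   [e]. *)
have Hq b j : (j < count_mem b s)%N -> `|q^`N(j).[b%:R]| <= e * j.+2%:R.
  move=> jb; have [eba|ba] := eqVneq b a.
    have := H b j.+1; rewrite rec eba subrr mul0r addr0 /= eqxx add1n ltnS.
    move=> /(_ _) /le_trans; apply; first by rewrite -eba.
    by rewrite ler_peMr // ler1n.
  have HH i : (i < count_mem b s)%N -> `|p^`N(i).[b%:R]| <= e.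
    by move=> ib; apply: H; rewrite /= (leq_trans ib) // leq_addl.
  elim: j jb => [|j IHj] jb.
    rewrite nderivn0; have := HH 0%N jb; rewrite nderivn0 rec0 => h.
    have h2 : `|(b%:R - a%:R) * q.[b%:R]| <= e * 2.
      have -> : (b%:R - a%:R) * q.[b%:R] =
        ((b%:R - a%:R) * q.[b%:R] + p.[a%:R]) - p.[a%:R] by ring.
      by rewrite (le_trans (ler_normB _ _)) // mulr_natr mulr2n lerD.
    apply: le_trans h2; rewrite normrM ler_peMl // dist //.
  have h := HH _ jb; rewrite rec in h.
  have h2 := IHj (ltnW jb).
  have h3 : `|(b%:R - a%:R) * q^`N(j.+1).[b%:R]| <= e * j.+3%:R.
    have -> : (b%:R - a%:R) * q^`N(j.+1).[b%:R] =
      (q^`N(j).[b%:R] + (b%:R - a%:R) * q^`N(j.+1).[b%:R]) - q^`N(j).[b%:R] by ring.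
    rewrite (le_trans (ler_normB _ _)) // -[j.+3]add1n natrD mulrDr mulr1.
    by rewrite lerD.
  by apply: le_trans h3; rewrite normrM ler_peMl // dist.
have sr' b : b \in s -> b%:R <= r by move=> bs; apply: sr; rewrite inE bs orbT.
have Hq' b j : (j < count_mem b s)%N -> `|q^`N(j).[b%:R]| <= T0%:R *+ 2 * e.
  move=> jb; apply: le_trans (Hq b j jb) _; rewrite mulrC ler_wpM2r //.
  rewrite -mulrnA ler_nat.
  by have := count_size (pred1 b) s; move: sT jb => /=; lia.
have e1 : 0 <= T0%:R *+ 2 * e by rewrite mulr_ge0 // mulrn_wge0.
have := IH sr' sT' n.-1 q _ x sq e1 Hq' xr.
have mj : majorant n.-1 r (size s) q <= majorant n r (size s).+1 p.
  case: n sp sq => [|n] sp sq.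
    by rewrite /majorant !big_ord0.
  by apply: majorant_quotient Ep => //; rewrite ger0_norm.
set M := majorant _ _ _ q in mj *; set M' := majorant _ _ _ p in mj *.
set t := T0%:R *+ 2; set k := (1 + _) ^+ _ => hq.
have t0 : 0 <= t by rewrite mulrn_wge0.
have k1 : 1 <= k by rewrite exprn_ege1 // lerDl mulr_ge0.
have Exp : p.[x] = (x - a%:R) * q.[x] + p.[a%:R].
  by rewrite {1}Ep !hornerE mulrC.
rewrite Exp /= !exprS -/k.
have xa : `|x - a%:R| <= r.
  rewrite ler_norml; case/andP: xr => x0 xr.
  by have a0 : 0 <= a%:R :> R by []; apply/andP; split; lra.
apply: le_trans (ler_normD _ _) _; rewrite normrM.
have h1 : `|x - a%:R| * `|q.[x]| <= r * (k * (t * e) + r ^+ size s * M').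
  apply: ler_pM => //; apply: le_trans hq _; rewrite lerD2l ler_wpM2l //.
  by rewrite exprn_ge0.
apply: le_trans (lerD h1 Hpa) _.
have : e <= k * e by rewrite ler_peMl.
set y := r ^+ size s; rewrite -subr_ge0 => h2; rewrite -subr_ge0.
by have -> : (1 + t * r) * k * e + r * y * M' - (r * (k * (t * e) + y * M') + e)
 = k * e - e by ring.
Qed.

End PolynomialInterpolation.

Section ExponentialSums.
Import numFieldNormedType.Exports.
Variable R : realType.
Implicit Types (w x y e W Y : R).

Definition exp_trunc M y : R := \sum_(k < M) y ^+ k / k`!%:R.

Lemma cvg_exp_trunc y : (exp_trunc^~ y @ \oo --> expR y)%classic.
Proof.
have -> : exp_trunc^~ y = series (exp_coeff y).
  by apply/funext => M; rewrite /series /= big_mkord.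
exact: is_cvg_series_exp_coeff.
Qed.

Lemma exp_trunc_tail M y Y : `|y| <= Y ->
  `|expR y - exp_trunc M y| <= expR Y - exp_trunc M Y.
Proof.
move=> yY; have Y0 : 0 <= Y by apply: le_trans yY.
have c1 : (`|exp_trunc n y - exp_trunc M y| @[n --> \oo] -->
            `|expR y - exp_trunc M y|)%classic.
  by apply: cvg_norm; apply: cvgB; [exact: cvg_exp_trunc | exact: cvg_cst].
have c2 : ((exp_trunc n Y - exp_trunc M Y) @[n --> \oo] -->
            (expR Y - exp_trunc M Y))%classic.
  by apply: cvgB; [exact: cvg_exp_trunc | exact: cvg_cst].
apply: (ler_cvg_to c1 c2); exists M => // n /= Mn.
rewrite -(subnKC Mn) /exp_trunc !big_split_ord /= ![_ + _ - _]addrAC !subrr !add0r.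
apply: le_trans (ler_norm_sum _ _ _) _; apply: ler_sum => k _.
rewrite normrM normrX [`|_^-1|]ger0_norm ?invr_ge0 //.
by rewrite ler_wpM2r ?invr_ge0 // lerXn2r ?nnegrE.
Qed.

Lemma exp_trunc_le M y : 0 <= y -> exp_trunc M y <= expR y.
Proof.
move=> y0; rewrite -subr_ge0; apply: le_trans (exp_trunc_tail M (y := y) _) => //.
by rewrite ger0_norm.
Qed.

(** Uniformity in [y] comes from comparing the tail at [y] with the tail at [Y]; one truncation then
    serves all exponentials and nodes at once. *)
Lemma exp_trunc_approx Y e : 0 < e -> exists M0, forall M y, (M0 <= M)%N ->
  `|y| <= Y -> `|expR y - exp_trunc M y| <= e.
Proof.
move=> e0; have /cvgrPdist_le /(_ e e0) [M0 _ H] := @cvg_exp_trunc Y.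
exists M0 => M y /H /= h yY; apply: le_trans (exp_trunc_tail M yY) _.
by apply: le_trans h; apply: ler_norm.
Qed.

Lemma powerfact_le_expR n y : 0 <= y -> y ^+ n / n`!%:R <= expR y.
Proof.
move=> y0; apply: le_trans (exp_trunc_le n.+1 y0).
rewrite /exp_trunc big_ord_recr /= lerDr; apply: sumr_ge0 => k _.
by rewrite mulr_ge0 ?exprn_ge0 ?invr_ge0.
Qed.

Definition exp_poly M w : {poly R} := \poly_(k < M) (w ^+ k / k`!%:R).

Lemma size_exp_poly M w : (size (exp_poly M w) <= M)%N.
Proof. exact: size_poly. Qed.

Lemma fact_neq0 k : k`!%:R != 0 :> R.
Proof. by rewrite pnatr_eq0 -lt0n fact_gt0. Qed.

Lemma bin_natr_fact j i :
  'C(j + i, j)%:R / (j + i)`!%:R = (j`!%:R)^-1 / i`!%:R :> R.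
Proof.
have := bin_fact (leq_addr i j); rewrite addKn => /(congr1 (fun n => n%:R : R)).
rewrite !natrM => <-; rewrite invfM mulrA mulfV ?mul1r ?invfM //.
by rewrite pnatr_eq0 -lt0n bin_gt0 leq_addr.
Qed.

Lemma nderivn_exp_poly M w j x :
  (exp_poly M w)^`N(j).[x] = w ^+ j / j`!%:R * exp_trunc (M - j) (w * x).
Proof.
have sz : (size ((exp_poly M w)^`N(j)) <= M - j)%N.
  by apply: leq_trans (size_poly _ _) _; rewrite leq_sub2r // size_exp_poly.
rewrite (horner_coef_wide _ sz) /exp_trunc mulr_sumr; apply: eq_bigr => i _.
rewrite coef_nderivn coef_poly; have -> : (j + i < M)%N by have := ltn_ord i; lia.
rewrite -[_ *+ 'C(_, _)]mulr_natr -[_ / _ * 'C(_, _)%:R]mulrA [_^-1 * _]mulrC bin_natr_fact exprD exprMn.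
by ring.
Qed.

(** After enlarging the range, the sum is the [T]-th normalised derivative at [r] of a Taylor
    polynomial of [exp (W x)]. The division by [T!] is what makes interpolation profitable. *)
Lemma majorant_exp_poly M r T w W : 0 <= r -> `|w| <= W ->
  majorant M r T (exp_poly M w) <= W ^+ T / T`!%:R * expR (W * r).
Proof.
move=> r0 wW; have W0 : 0 <= W by apply: le_trans wW.
pose g k : R := W ^+ k / k`!%:R * 'C(k, T)%:R * r ^+ (k - T).
have g0 k : 0 <= g k by rewrite /g !mulr_ge0 ?exprn_ge0 ?invr_ge0.
have le1 : majorant M r T (exp_poly M w) <= \sum_(k < M) g k.
  apply: ler_sum => k _; rewrite coef_poly ltn_ord.
  rewrite ler_wpM2r ?exprn_ge0 // ler_wpM2r // normrM normrX.
  rewrite [`|_^-1|]ger0_norm ?invr_ge0 //.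
  by rewrite ler_wpM2r ?invr_ge0 // lerXn2r ?nnegrE.
apply: le_trans le1 _.
have le2 : \sum_(k < M) g k <= \sum_(k < T + M) g k.
  by rewrite addnC big_split_ord /= lerDl sumr_ge0.
apply: le_trans le2 _; rewrite big_split_ord /= big1 ?add0r; last first.
  by move=> i _; rewrite /g bin_small // mulr0 mul0r.
have -> : \sum_(i < M) g (T + i)%N = W ^+ T / T`!%:R * exp_trunc M (W * r).
  rewrite /exp_trunc mulr_sumr; apply: eq_bigr => i _.
  rewrite /g addKn -[_ / _ * 'C(_, _)%:R]mulrA [_^-1 * _]mulrC bin_natr_fact exprD exprMn.
  by ring.
apply: ler_wpM2l; first by rewrite mulr_ge0 ?exprn_ge0 ?invr_ge0.
by apply: exp_trunc_le; rewrite mulr_ge0.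
Qed.

(** Each point below [n] is repeated [S] times, so that [S] derivatives are prescribed there. *)
Fixpoint nodes (S n : nat) : seq nat :=
  if n is n'.+1 then nseq S n' ++ nodes S n' else [::].

Lemma size_nodes S n : size (nodes S n) = (n * S)%N.
Proof. by elim: n => //= n IH; rewrite size_cat size_nseq IH mulSn. Qed.

Lemma count_nodes S n b : count_mem b (nodes S n) = ((b < n) * S)%N.
Proof.
elim: n => //= n IH; rewrite count_cat count_nseq IH /=.
by have [bn|bn|bn] := ltngtP b n; nia.
Qed.

Lemma mem_nodes S n b : b \in nodes S n -> (b < n)%N.
Proof. by rewrite -has_pred1 has_count count_nodes; case: (b < n)%N. Qed.

(** Newton interpolation applies once each exponential is replaced by a long Taylor polynomial. The
    first term of the bound collects the errors at the nodes and of the truncation, the second is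
    the interpolation remainder. *)
Lemma expsum_interpolation (I : finType) (c w : I -> R) W e (r n S x : nat) :
  0 <= W -> (forall i, `|w i| <= W) -> 0 < e ->
  (forall b j, (b < n)%N -> (j < S)%N ->
     `|\sum_i c i * w i ^+ j * expR (w i * b%:R)| <= e) ->
  (n <= r)%N -> (x <= r)%N ->
  `|\sum_i c i * expR (w i * x%:R)| <=
    ((1 + (n * S)%:R *+ 2 * r%:R) ^+ (n * S) *+ 2 + 1) * e +
    (\sum_i `|c i|) * ((r%:R * W) ^+ (n * S) / (n * S)`!%:R * expR (W * r%:R)).
Proof.
move=> W0 wW e0 H nr xr; set T := (n * S)%N.
pose C : R := \sum_i `|c i|; have C0 : 0 <= C by apply: sumr_ge0.
(* An error [e / D] in each exponential, weighted by [c i] and at most [S] factors [w i], adds up to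
   at most [e]. *)
pose D : R := 1 + C * (1 + W) ^+ S.
have V1 : 1 <= 1 + W by rewrite lerDl.
have D1 : 1 <= D by rewrite lerDl mulr_ge0 ?exprn_ge0 // (le_trans ler01).
have D0 : 0 < D by apply: lt_le_trans D1.
have ed0 : 0 < e / D by rewrite divr_gt0.
have [M0 HM] := exp_trunc_approx (W * r%:R) ed0.
have Wb i b : (b <= r)%N -> `|w i * b%:R| <= W * r%:R.
  by move=> br; rewrite normrM normr_nat ler_pM ?ler_nat.
(* Differentiating [j <= S] times shortens the truncation by [j], which still leaves [M0] terms. *)
pose M := (M0 + S)%N.
pose p : {poly R} := \sum_i c i *: exp_poly M (w i).
have sp : (size p <= M)%N.
  apply: leq_trans (size_sum _ _ _) _; apply/bigmax_leqP => i _.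
  by apply: leq_trans (size_scale_leq _ _) _; apply: size_exp_poly.
have approx b j : (b <= r)%N -> (j <= S)%N ->
   `|p^`N(j).[b%:R] * j`!%:R - \sum_i c i * w i ^+ j * expR (w i * b%:R)| <= e.
  move=> br jS; rewrite linear_sum horner_sum mulr_suml -sumrB.
  apply: le_trans (ler_norm_sum _ _ _) _.
  apply: (@le_trans _ _ (\sum_i `|c i| * (1 + W) ^+ S * (e / D))); last first.
    rewrite -!mulr_suml -/C mulrA ler_pdivrMr // [e * D]mulrC.
    by apply: ler_wpM2r; rewrite ?(ltW e0) // lerDr.
  apply: ler_sum => i _; rewrite /= nderivnZ hornerZ nderivn_exp_poly.
  have -> : c i * (w i ^+ j / j`!%:R * exp_trunc (M - j) (w i * b%:R)) * j`!%:R -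
    c i * w i ^+ j * expR (w i * b%:R) =
    - (c i * w i ^+ j * (expR (w i * b%:R) - exp_trunc (M - j) (w i * b%:R))).
    by field; apply: fact_neq0.
  rewrite normrN !normrM -[X in _ <= X]mulrA -[X in X <= _]mulrA ler_wpM2l //.
  apply: ler_pM => //; last by apply: HM; [rewrite /M; lia | exact: Wb].
  rewrite normrX; apply: (@le_trans _ _ ((1 + W) ^+ j)).
    by rewrite lerXn2r ?nnegrE // ?addr_ge0 // (le_trans (wW i)) // lerDr.
  by rewrite ler_weXn2l.
have Hp b j : (j < count_mem b (nodes S n))%N -> `|p^`N(j).[b%:R]| <= e *+ 2.
  rewrite count_nodes; case: (ltnP b n) => bn; rewrite ?mul0n // mul1n => jS.
  have h1 := approx b j (leq_trans (ltnW bn) nr) (ltnW jS).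
  have h2 := H b j bn jS.
  have : `|p^`N(j).[b%:R] * j`!%:R| <= e *+ 2.
    rewrite -[X in `|X|](subrK (\sum_i c i * w i ^+ j * expR (w i * b%:R))).
    by rewrite (le_trans (ler_normD _ _)) // mulr2n lerD.
  apply: le_trans; rewrite normrM ler_peMr // normr_nat ler1n fact_gt0 //.
have e20 : 0 <= e *+ 2 by rewrite mulrn_wge0 // ltW.
have r0 : 0 <= r%:R :> R by [].
have sr b : b \in nodes S n -> b%:R <= r%:R :> R.
  by move=> /mem_nodes bn; rewrite ler_nat; lia.
have xr' : 0 <= (x%:R : R) <= r%:R by rewrite ler_nat xr andbT.
have := interpolation_bound r0 sr (leqnn _) sp e20 Hp xr'.
rewrite size_nodes -/T => hp.
have mj : majorant M r%:R T p <= C * (W ^+ T / T`!%:R * expR (W * r%:R)).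
  rewrite mulr_suml; apply: (@le_trans _ _ (\sum_i `|c i| * majorant M r%:R T (exp_poly M (w i)))).
    rewrite /majorant.
    under [leRHS]eq_bigr do rewrite mulr_sumr.
    rewrite exchange_big; apply: ler_sum => k _ /=.
    under [leRHS]eq_bigr do rewrite 2!mulrA.
    rewrite -!mulr_suml ler_wpM2r ?exprn_ge0 // ler_wpM2r //.
    rewrite coef_sum; apply: le_trans (ler_norm_sum _ _ _) _.
    by apply: ler_sum => i _; rewrite coefZ normrM.
  by apply: ler_sum => i _; rewrite ler_wpM2l // majorant_exp_poly.
have ha := approx x 0%N xr (leq0n _).
rewrite nderivn0 mulr1 in ha.
have Ef : \sum_i c i * w i ^+ 0 * expR (w i * x%:R) = \sum_i c i * expR (w i * x%:R).
  by apply: eq_bigr => i _; rewrite expr0 mulr1.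
rewrite Ef distrC in ha.
rewrite -[X in `|X|](subrK p.[x%:R]).
apply: le_trans (ler_normD _ _) _; apply: le_trans (lerD ha hp) _.
set A := (1 + _) ^+ T.
have h3 : r%:R ^+ T * majorant M r%:R T p <=
   C * ((r%:R * W) ^+ T / T`!%:R * expR (W * r%:R)).
  apply: le_trans (ler_wpM2l _ mj) _; first by rewrite exprn_ge0.
  by rewrite exprMn le_eqVlt; apply/orP; left; apply/eqP; ring.
have -> : (A *+ 2 + 1) * e = e + A * (e *+ 2) by ring.
by rewrite -addrA lerD2l lerD2l.
Qed.

End ExponentialSums.

(** * Pigeonhole and separation of coefficients *)

(** Each integer vector with entries in [[0, Q]] is sent to the box of side [d] containing its
    values. There are more vectors than boxes, and the difference of two vectors in one box is the
    solution. *)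
Lemma pigeonhole_forms (R : realType) (I F : finType) (a : F -> I -> R)
    (Z d : R) (Q : nat) : 0 < d -> 0 <= Z -> (forall f i, `|a f i| <= Z) ->
  (2 * #|I|%:R * Q%:R * Z / d + 1) ^+ #|F| < Q.+1%:R ^+ #|I| ->
  exists p : I -> int, [/\ exists i, p i != 0, forall i, (`|p i| <= Q)%N
    & forall f, `|\sum_i (p i)%:~R * a f i| <= d].
Proof.
move=> d0 Z0 aZ card.
(* The shift by [#|I| Q Z] makes all values nonnegative, so that truncation sorts them into boxes
   faithfully. *)
pose y f (x : {ffun I -> 'I_Q.+1}) : R :=
  \sum_i (x i : nat)%:R * a f i + #|I|%:R * Q%:R * Z.
pose b : R := 2 * #|I|%:R * Q%:R * Z / d.
have b0 : 0 <= b by rewrite /b divr_ge0 ?mulr_ge0 // ltW.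
have yb f x : 0 <= y f x / d <= b.
  have h : `|\sum_i (x i : nat)%:R * a f i| <= #|I|%:R * Q%:R * Z.
    apply: le_trans (ler_norm_sum _ _ _) _.
    apply: (@le_trans _ _ (\sum_(i : I) (Q%:R * Z))); last first.
      by rewrite sumr_const -[X in X <= _]mulr_natl -mulrA.
    apply: ler_sum => i _; rewrite normrM normr_nat ler_pM // ler_nat.
    by rewrite -ltnS.
  move: h; rewrite ler_norml => /andP[h1 h2].
  have y0 : 0 <= y f x by rewrite /y; lra.
  rewrite divr_ge0 ?(ltW d0) //=.
  rewrite /b ler_pM2r ?invr_gt0 // /y.
  have -> : 2 * #|I|%:R * Q%:R * Z = #|I|%:R * Q%:R * Z + #|I|%:R * Q%:R * Z by ring.
  by rewrite lerD2r.
pose g x : {ffun F -> 'I_(Num.truncn b).+1} :=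
  [ffun f => inord (Num.truncn (y f x / d))].
have : ~~ injectiveb g.
  apply/negP => /injectiveP /leq_card; rewrite !card_ffun !card_ord leqNgt.
  move=> /negP; apply; rewrite -(ltr_nat R) !natrX.
  apply: le_lt_trans card; rewrite lerXn2r ?nnegrE ?addr_ge0 // -/b.
  by rewrite -natr1 lerD2r; case/andP: (truncn_itv b0).
case/injectivePn => x [x' xx' gx].
exists (fun i => (x i : nat)%:Z - (x' i : nat)%:Z); split.
- apply/existsP; rewrite -[X in is_true X]negbK; apply/negP.
  rewrite negb_exists => /forallP h.
  move/eqP: xx'; apply; apply/ffunP => i; apply/val_inj.
  have := h i; rewrite negbK subr_eq0 => /eqP [] //.
- move=> i; have h1 := ltn_ord (x i); have h2 := ltn_ord (x' i).
  rewrite -ltnS; lia.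
- move=> f.
  have -> : \sum_i ((x i : nat)%:Z - (x' i : nat)%:Z)%:~R * a f i = (y f x / d - y f x' / d) * d.
    rewrite -mulrBl divfK ?gt_eqF // /y opprD addrACA subrr addr0 -sumrB.
    by apply: eq_bigr => i _; rewrite rmorphB /= mulrBl.
  have ltG x0 : (Num.truncn (y f x0 / d) < (Num.truncn b).+1)%N.
    by case/andP: (yb f x0) => h1 h2; rewrite ltnS; apply: le_truncn.
  have Et : Num.truncn (y f x / d) = Num.truncn (y f x' / d).
    have := congr1 (fun h : {ffun F -> 'I_(Num.truncn b).+1} => (h f : nat)) gx.
    by rewrite !ffunE !inordK.
  case/andP: (yb f x) => /truncn_itv/andP[h1 h2] _.
  case/andP: (yb f x') => /truncn_itv/andP[h3 h4] _.
  rewrite Et -natr1 in h1 h2; rewrite -natr1 in h4.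
  rewrite normrM (gtr0_norm d0) -[leRHS]mul1r ler_pM2r // ler_norml.
  by apply/andP; split; lra.
Qed.

Lemma separated_coefficient_eq0 (R : fieldType) (I : finType)
    (p u v th : I -> R) (S n : nat) (i0 : I) :
  (forall i j x, (i + j < S)%N -> (x < n)%N ->
     \sum_k p k * u k ^+ i * v k ^+ j * th k ^+ x = 0) ->
  (#|I| <= n)%N -> (#|[pred k | th k == th i0]| <= S)%N ->
  (forall k, th k = th i0 -> u k = u i0 -> v k = v i0 -> k = i0) ->
  p i0 = 0.
Proof.
move=> H In cS sep.
(* [P.[u k] * Q.[v k] * T.[th k]] vanishes at every index except [i0]. *)
pose A := [pred k | (th k == th i0) && (u k != u i0)].
pose B := [pred k | [&& th k == th i0, u k == u i0 & k != i0]].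
pose C := [pred k | th k != th i0].
pose P := \prod_(k <- enum A) ('X - (u k)%:P).
pose Q := \prod_(k <- enum B) ('X - (v k)%:P).
pose T := \prod_(k <- enum C) ('X - (th k)%:P).
have sP : size P = #|A|.+1 by rewrite size_prod_XsubC cardE.
have sQ : size Q = #|B|.+1 by rewrite size_prod_XsubC cardE.
have sT : size T = #|C|.+1 by rewrite size_prod_XsubC cardE.
(* [A] and [B] are disjoint parts of the fibre of [th i0] and both miss [i0], so the degrees of [P]
   and [Q] add up to less than [S]. *)
have cAB : (#|A| + #|B| < S)%N.
  apply: leq_trans cS.
  rewrite (cardD1 i0 [pred k | th k == th i0]) inE eqxx add1n ltnS.
  rewrite -cardUI [X in (_ + X)%N]eq_card0 ?addn0; last first.
    by move=> k; rewrite !inE; case: (u k == u i0); rewrite ?andbF ?andbT.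
  apply: subset_leq_card; apply/fintype.subsetP => k; rewrite !inE.
  case/orP => [/andP[-> h]|/and3P[-> _ ->]] //; rewrite andbT.
  by apply: contraNneq h => ->.
have cC : (#|C| < n)%N.
  apply: leq_trans In; rewrite -(cardC C) -[X in (X < _)%N]addn0 ltn_add2l.
  by apply/card_gt0P; exists i0; rewrite !inE eqxx.
have E0 : \sum_k p k * P.[u k] * Q.[v k] * T.[th k] = 0.
  have E k : p k * P.[u k] * Q.[v k] * T.[th k] =
    \sum_(c < size T) \sum_(b < size Q) \sum_(a < size P)
      P`_a * Q`_b * T`_c * (p k * u k ^+ a * v k ^+ b * th k ^+ c).
    rewrite (horner_coef P) (horner_coef Q) (horner_coef T).
    rewrite mulr_sumr; apply: eq_bigr => c _.
    rewrite mulr_sumr mulr_suml; apply: eq_bigr => b _.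
    rewrite mulr_sumr !mulr_suml; apply: eq_bigr => a _; ring.
  under eq_bigr do rewrite E.
  rewrite exchange_big /= big1 // => c _; rewrite exchange_big /= big1 // => b _.
  rewrite exchange_big /= big1 // => a _.
  have := H a b c; rewrite (leq_ltn_trans _ cAB) ?(leq_trans (ltn_ord c)) ?sT //; last first.
    have := ltn_ord a; have := ltn_ord b; rewrite {2}sP {2}sQ !ltnS => h1 h2.
    exact: leq_add.
  move=> /(_ isT isT) h.
  by rewrite -mulr_sumr h mulr0.
have Z s (f : I -> R) x : (\prod_(k <- s) ('X - (f k)%:P)).[x] == 0 -> exists2 k, k \in s & x = f k.
  rewrite horner_prod prodf_seq_eq0 => /hasP[k ks].
  by rewrite hornerXsubC subr_eq0 => /eqP; exists k.
have zero s (f : I -> R) k : k \in s -> (\prod_(k <- s) ('X - (f k)%:P)).[f k] = 0.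
  move=> ks; apply/eqP; rewrite horner_prod prodf_seq_eq0; apply/hasP.
  by exists k => //=; rewrite hornerXsubC subrr.
move: E0; rewrite (bigD1 i0) //= big1 ?addr0; last first.
  move=> k ki0; have [tk|tk] := eqVneq (th k) (th i0); last first.
    by rewrite [T.[_]]zero ?mulr0 // mem_enum.
  have [uk|uk] := eqVneq (u k) (u i0); last first.
    by rewrite [P.[_]]zero ?mulr0 ?mul0r // mem_enum !inE tk eqxx.
  by rewrite [Q.[_]]zero ?mulr0 ?mul0r // mem_enum !inE tk uk !eqxx ki0.
move=> /eqP; rewrite !mulf_eq0 -!orbA => /or4P[/eqP//|/Z|/Z|/Z] [k]; rewrite mem_enum !inE.
- by move=> /andP[_ /eqP h] /esym.
- by case/and3P => /eqP h1 /eqP h2 /eqP h3 h4; case: h3; apply: sep.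
- by move=> /eqP h /esym.
Qed.

(** * A lower bound for linear forms in three logarithms *)

Lemma scaled_power_le (R : realFieldType) (x c : R) (a b : nat) :
  1 <= x -> c <= x -> (a < b)%N -> c * x ^+ a <= x ^+ b.
Proof.
move=> x1 cx ab; have x0 : 0 <= x by apply: le_trans x1.
apply: (@le_trans _ _ (x ^+ a.+1)); last by rewrite ler_weXn2l.
by rewrite exprS ler_wpM2r // exprn_ge0.
Qed.

Lemma expR_sub1_bound (R : realType) (y : R) : `|y| <= 1 / 2 -> `|1 - expR y| <= 2 * `|y|.
Proof.
move=> hy; have h1 := expR_ge1Dx y; have h2 := expR_ge1Dx (- y).
have h3 := expR_gt0 y; have h4 : expR y * expR (- y) = 1 by rewrite expRxMexpNx_1.
have [y0|y0] := leP 0 y.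
  rewrite (ger0_norm y0) in hy *; rewrite ler0_norm ?opprB; last by lra.
  have h5 := ler_wpM2l (ltW h3) h2; rewrite h4 in h5.
  have h6 : expR y <= 2 by nra.
  nra.
rewrite (ltr0_norm y0) in hy *; rewrite ger0_norm; first by lra.
rewrite subr_ge0 expR_le1; exact: ltW.
Qed.

Lemma expR_beats_power (R : realType) (k : nat) (c : R) :
  exists C : R, forall x, C <= x -> c * x ^+ k <= expR x.
Proof.
exists (Num.max 1 (c * k.+1`!%:R)) => x; rewrite ge_max => /andP[x1 cx].
have x0 : 0 <= x by apply: le_trans x1.
apply: le_trans (powerfact_le_expR k.+1 x0).
have f0 : 0 < k.+1`!%:R :> R by rewrite ltr0n fact_gt0.
rewrite ler_pdivlMr // exprS -mulrA [x ^+ k * _]mulrC mulrA.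
by rewrite ler_wpM2r // exprn_ge0.
Qed.

(* [L = t^10] exponents per base, [2^J t^13] derivatives and [t^3] points at the start; each
   of the [J] extrapolation rounds halves the former and multiplies the latter by [t]. The
   final [t^30 = L^3] points and [t^13 >= L] derivatives separate all coefficients. The
   number of rounds is kept as a variable so that [2 ^ J] is never evaluated. *)
Section BakerCore.
Variables (R : realType) (a1 a2 a3 : R) (b1 b2 : int) (t k0 J : nat).
Let tau : R := t%:R.
Let L := (t ^ 10)%N.
Let I : finType := ('I_L * 'I_L * 'I_L)%type.
Let Lam : R := ln a3 - b1%:~R * ln a1 - b2%:~R * ln a2.
Let u (l : I) : int := (l.1.1 : nat)%:Z + (l.2 : nat)%:Z * b1.
Let v (l : I) : int := (l.1.2 : nat)%:Z + (l.2 : nat)%:Z * b2.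
Let th (l : I) : R := a1 ^+ l.1.1 * a2 ^+ l.1.2 * a3 ^+ l.2.

Hypothesis a1_gt0 : 0 < a1.
Hypothesis a2_gt0 : 0 < a2.
Hypothesis a3_gt0 : 0 < a3.
Hypothesis ln1 : `|ln a1| <= tau.
Hypothesis ln2 : `|ln a2| <= tau.
Hypothesis ln3 : `|ln a3| <= tau.
Hypothesis b1_le : `|b1%:~R| <= expR tau.
Hypothesis b2_le : `|b2%:~R| <= expR tau.
Hypothesis indep : forall i j i' j' : nat,
  a1 ^+ i * a2 ^+ j = a1 ^+ i' * a2 ^+ j' -> i = i' /\ j = j'.
Hypothesis liouville : forall (x : nat) (c : I -> int) (y : R), 0 <= y ->
  \sum_l `|(c l)%:~R| <= expR y ->
  \sum_l (c l)%:~R * th l ^+ x != 0 ->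
  expR (- (k0%:R * (y + tau * L%:R * x.+1%:R))) <= `|\sum_l (c l)%:~R * th l ^+ x|.
Hypothesis Lam_neq0 : Lam != 0.
Hypothesis Lam_small : `|Lam| <= expR (- tau ^+ 60).
Hypothesis J27 : J = 27.
Hypothesis tau_exp : 3 * tau ^+ 80 <= expR tau.
Hypothesis tau_big : (4 * k0%:R + 16) * 4 ^+ J <= tau.

Let P : R := 2 ^+ J.
Let S0 := (2 ^ J * t ^ 13)%N.
(** [Z] is the scale of the logarithms of all coefficients; [W] will bound the frequencies [w l]. *)
Let Z : R := tau ^+ 15.
Let W : R := 4 * tau ^+ 11.
(** [th l ^+ x] differs from [expR (w l * x)] by the factor [expR (l3 Lam x)], near 1 when [Lam] is
    tiny. Differentiating in [x] brings down [w l], a combination of [u l] and [v l]. *)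
Let w (l : I) : R := (u l)%:~R * ln a1 + (v l)%:~R * ln a2.

Let P1 : 1 <= P. Proof. by rewrite exprn_ege1 // ler1n. Qed.
Let PP : 4 ^+ J = P ^+ 2 :> R.
Proof. by rewrite -exprM mulnC exprM; congr (_ ^+ _); rewrite expr2 -natrM. Qed.
Let k00 : 0 <= k0%:R :> R. Proof. by []. Qed.

Let big1 : (4 * k0%:R + 16) * P ^+ 2 <= tau. Proof. by rewrite -PP. Qed.
Let big2 : (4 * k0%:R + 16) * P <= tau.
Proof.
have c0 : 0 <= 4 * k0%:R + 16 :> R by have := k00; lra.
by apply: le_trans big1; rewrite expr2 mulrA ler_peMr // mulr_ge0 // (le_trans ler01).
Qed.
Let big3 : 4 * k0%:R + 16 <= tau.
Proof. by apply: le_trans big2; rewrite ler_peMr //; have := k00; lra. Qed.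
Let tau1 : 1 <= tau. Proof. by have := k00; have := big3; lra. Qed.
Let tau0 : 0 < tau. Proof. by apply: lt_le_trans tau1. Qed.
Let pw c a b : c <= 4 * k0%:R + 16 -> (a < b)%N -> c * tau ^+ a <= tau ^+ b.
Proof. by move=> h; apply: scaled_power_le => //; apply: le_trans h big3. Qed.
Let pw1 a b : (a <= b)%N -> tau ^+ a <= tau ^+ b.
Proof. by move=> h; rewrite ler_weXn2l. Qed.
Let pe a : (a <= 80)%N -> 3 * tau ^+ a <= expR tau.
Proof. by move=> h; apply: le_trans tau_exp; rewrite ler_pM2l // pw1. Qed.
Let LE : L%:R = tau ^+ 10 :> R. Proof. by rewrite natrX. Qed.
Let S0E : S0%:R = P * tau ^+ 13 :> R. Proof. by rewrite natrM !natrX. Qed.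
Let cardI : #|I|%:R = tau ^+ 30 :> R.
Proof. by rewrite 2!card_prod card_ord 2!natrM LE -!exprD. Qed.

Let lL (i : 'I_L) : (i : nat)%:R <= tau ^+ 10 :> R.
Proof. by rewrite -LE ler_nat ltnW. Qed.

Let gen_bound (i j : 'I_L) (b : int) : `|b%:~R| <= expR tau :> R ->
  `|((i : nat)%:Z + (j : nat)%:Z * b)%:~R| <= expR (2 * tau) :> R.
Proof.
move=> hb; rewrite rmorphD rmorphM /=; apply: le_trans (ler_normD _ _) _.
have h1 : `|(i : nat)%:R| <= tau ^+ 10 :> R by rewrite normr_nat.
have h2 : `|(j : nat)%:R * b%:~R| <= tau ^+ 10 * expR tau :> R.
  by rewrite normrM normr_nat ler_pM.
apply: le_trans (lerD h1 h2) _.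
have -> : 2 * tau = tau + tau by ring.
rewrite expRD; have h3 := @pe 10 isT.
have h4 : 0 <= tau ^+ 10 by rewrite exprn_ge0 // ltW.
have h5 : 1 <= expR tau by rewrite -expR0 ler_expR ltW.
nra.
Qed.

Let u_le l : `|(u l)%:~R| <= expR (2 * tau) :> R. Proof. exact: gen_bound. Qed.
Let v_le l : `|(v l)%:~R| <= expR (2 * tau) :> R. Proof. exact: gen_bound. Qed.

Let thE l : th l = expR (w l + (l.2 : nat)%:R * Lam).
Proof.
rewrite /th -[a1 in LHS](@lnK R) ?posrE // -[a2 in LHS](@lnK R) ?posrE //.
rewrite -[a3 in LHS](@lnK R) ?posrE // -!expRM_natr -!expRD; congr expR.
rewrite /w /Lam /u /v !rmorphD !rmorphM /=; ring.
Qed.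

Let Lam1 : `|Lam| <= 1.
Proof.
apply: le_trans Lam_small _; rewrite -expR0 ler_expR oppr_le0.
by rewrite exprn_ge0 // ltW.
Qed.

(** [u l] and [v l] may be of size [expR (2 * tau)], but their large parts combine to
    [l3 (ln a3 - Lam)], so the frequencies stay polynomial in [tau]. *)
Let w_le l : `|w l| <= W.
Proof.
have -> : w l = (l.1.1 : nat)%:R * ln a1 + (l.1.2 : nat)%:R * ln a2 +
   (l.2 : nat)%:R * (ln a3 - Lam).
  by rewrite /w /Lam /u /v !rmorphD !rmorphM /=; ring.
have t10 : 0 <= tau ^+ 10 by rewrite exprn_ge0 // ltW.
have h (i : 'I_L) (y z : R) : `|y| <= z -> `|(i : nat)%:R * y| <= tau ^+ 10 * z.
  by move=> yz; rewrite normrM normr_nat ler_pM.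
have h3 : `|ln a3 - Lam| <= 2 * tau.
  apply: le_trans (ler_normB _ _) _; have := ln3; have := Lam1; have := tau1; lra.
apply: le_trans (ler_normD _ _) _; apply: le_trans (lerD (ler_normD _ _) (lexx _)) _.
apply: le_trans (lerD (lerD (h _ _ _ ln1) (h _ _ _ ln2)) (h _ _ _ h3)) _.
by rewrite /W exprS le_eqVlt; apply/orP; left; apply/eqP; ring.
Qed.

Let Z0 : 0 <= Z. Proof. by rewrite exprn_ge0 // ltW. Qed.

Let uv_le i j l : (i + j <= 2 * S0)%N ->
  `|(u l)%:~R ^+ i * (v l)%:~R ^+ j| <= expR Z :> R.
Proof.
move=> ij; rewrite normrM !normrX.
apply: (@le_trans _ _ (expR (2 * tau) ^+ i * expR (2 * tau) ^+ j)).
  by apply: ler_pM; rewrite ?exprn_ge0 // lerXn2r ?nnegrE ?expR_ge0.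
rewrite -exprD -expRM_natr ler_expR.
have h : (i + j)%:R <= 2 * S0%:R :> R by rewrite -natrM ler_nat.
have h2 : (2 * tau) * (i + j)%:R <= (2 * tau) * (2 * S0%:R).
  by rewrite ler_pM2l // mulr_gt0.
apply: le_trans h2 _; rewrite S0E.
have -> : 2 * tau * (2 * (P * tau ^+ 13)) = (4 * P) * tau ^+ 14 by rewrite [tau ^+ 14]exprS; ring.
apply: scaled_power_le => //; apply: le_trans big2.
by rewrite ler_wpM2r ?(le_trans _ P1) //; have := k00; lra.
Qed.

(** * Extrapolation for fixed integer coefficients *)

Section FixedCoefficients.
Variable p : I -> int.
Hypothesis p_le : forall l, `|(p l)%:~R| <= expR Z :> R.

Let Aval (i j x : nat) : R :=
  \sum_l (p l)%:~R * (u l)%:~R ^+ i * (v l)%:~R ^+ j * th l ^+ x.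

Let coef_le i j : (i + j <= 2 * S0)%N ->
  \sum_l `|(p l)%:~R * (u l)%:~R ^+ i * (v l)%:~R ^+ j| <= expR (3 * Z) :> R.
Proof.
move=> ij.
apply: (@le_trans _ _ (\sum_(l : I) expR (2 * Z))).
  apply: ler_sum => l _; rewrite -mulrA normrM.
  have -> : 2 * Z = Z + Z by ring.
  by rewrite expRD ler_pM // uv_le.
rewrite sumr_const -[X in X <= _]mulr_natl.
have -> : #|(fun=> true) : pred I| = #|I| by apply: eq_card.
rewrite cardI.
have -> : 3 * Z = Z + 2 * Z by ring.
rewrite expRD ler_wpM2r ?expR_ge0 //.
have h : expR tau <= expR Z by rewrite ler_expR /Z -{1}[tau]expr1 pw1.
apply: le_trans h; have := @pe 30 isT.
have : 0 <= tau ^+ 30 by rewrite exprn_ge0 // ltW.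
lra.
Qed.

(** The vanishing test after each extrapolation: the coefficients [p u^i v^j] are integers of total
    size at most [expR (3 * Z)], so a value below Liouville's bound is zero. *)
Let liou i j x (r : R) : (i + j <= 2 * S0)%N -> x.+1%:R <= r ->
  `|Aval i j x| < expR (- (k0%:R * (3 * Z + tau ^+ 11 * r))) -> Aval i j x = 0.
Proof.
move=> ij xr hA; apply/eqP/negPn/negP => A0.
pose c l := p l * u l ^+ i * v l ^+ j.
have E : Aval i j x = \sum_l (c l)%:~R * th l ^+ x.
  by apply: eq_bigr => l _; rewrite /c !rmorphM !rmorphXn.
have hc : \sum_l `|(c l)%:~R| <= expR (3 * Z) :> R.
  apply: le_trans (coef_le ij); rewrite le_eqVlt; apply/orP; left; apply/eqP.
  by apply: eq_bigr => l _; rewrite /c !rmorphM !rmorphXn.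
rewrite E in A0 hA; have Z30 : 0 <= 3 * Z by rewrite mulr_ge0.
move: hA; rewrite ltNge => /negP; apply.
apply: le_trans (liouville Z30 hc A0); rewrite ler_expR lerN2 ler_wpM2l //.
rewrite lerD2l LE -exprS ler_wpM2l // exprn_ge0 // ltW.
Qed.

Let diff_le (l : I) (x r : nat) : (x <= r)%N -> r%:R <= tau ^+ 31 ->
  `|expR (w l * x%:R) - th l ^+ x| <=
  expR (W * r%:R) * (2 * (tau ^+ 10 * r%:R * expR (- tau ^+ 60))).
Proof.
move=> xr rt; rewrite thE -expRM_natr (mulrDl (w l)) (expRD (w l * x%:R)).
set y := (l.2 : nat)%:R * Lam * x%:R.
have hy : `|y| <= tau ^+ 10 * r%:R * expR (- tau ^+ 60).
  rewrite /y !normrM !normr_nat mulrAC; apply: ler_pM => //.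
  by apply: ler_pM => //; rewrite ler_nat.
have hy2 : `|y| <= 1 / 2.
  apply: le_trans hy _; rewrite expRN ler_pdivrMr ?expR_gt0 //.
  have h1 : tau ^+ 10 * r%:R <= tau ^+ 41.
    by rewrite -[41%N]/(10 + 31)%N exprD ler_wpM2l // exprn_ge0 // ltW.
  have h2 : expR tau <= expR (tau ^+ 60) by rewrite ler_expR -{1}[tau]expr1 pw1.
  have h3 := @pe 41 isT.
  have h4 : 0 <= tau ^+ 41 by rewrite exprn_ge0 // ltW.
  lra.
have -> : expR (w l * x%:R) - expR (w l * x%:R) * expR y = expR (w l * x%:R) * (1 - expR y) by ring.
rewrite normrM ger0_norm ?expR_ge0 //; apply: ler_pM; rewrite ?expR_ge0 //.
  rewrite ler_expR; apply: le_trans (ler_norm _) _; rewrite normrM normr_nat.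
  by apply: ler_pM => //; rewrite ler_nat.
apply: le_trans (expR_sub1_bound hy2) _; by rewrite ler_pM2l.
Qed.


(** The exponential sum on which the extrapolation acts; at integers up to [r] it stays within
    [err r] of [Aval]. *)
Let phi (i j x : nat) : R :=
  \sum_l (p l)%:~R * (u l)%:~R ^+ i * (v l)%:~R ^+ j * expR (w l * x%:R).
Let err (r : nat) : R :=
  expR (3 * Z) * (expR (W * r%:R) * (2 * (tau ^+ 10 * r%:R * expR (- tau ^+ 60)))).

Let err_ge0 r : 0 <= err r.
Proof. by rewrite /err !mulr_ge0 ?expR_ge0 // exprn_ge0 // ltW. Qed.

Let phi_err i j x r : (i + j <= 2 * S0)%N -> (x <= r)%N -> r%:R <= tau ^+ 31 ->
  `|phi i j x - Aval i j x| <= err r.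
Proof.
move=> ij xr rt; rewrite /phi /Aval -sumrB; apply: le_trans (ler_norm_sum _ _ _) _.
have e0 : 0 <= expR (W * r%:R) * (2 * (tau ^+ 10 * r%:R * expR (- tau ^+ 60))).
  by rewrite !mulr_ge0 ?expR_ge0 // exprn_ge0 // ltW.
apply: le_trans (ler_wpM2r e0 (coef_le ij)); rewrite mulr_suml.
apply: ler_sum => l _; rewrite -mulrBr normrM ler_wpM2l //; exact: diff_le.
Qed.

(** The binomial expansion of [w l ^+ a] writes this derivative through sums [phi i' j' b] with
    [i' + j' = i + j + a], each within [err r] of a vanishing [Aval]. *)
Let phi_deriv i j a b r : (i + j + a <= 2 * S0)%N -> (b <= r)%N ->
  r%:R <= tau ^+ 31 -> (forall i' j', (i' + j' <= i + j + a)%N -> Aval i' j' b = 0) ->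
  `|\sum_l (p l)%:~R * (u l)%:~R ^+ i * (v l)%:~R ^+ j * w l ^+ a * expR (w l * b%:R)|
   <= (tau + tau) ^+ a * err r.
Proof.
move=> ij br rt H.
have -> : \sum_l (p l)%:~R * (u l)%:~R ^+ i * (v l)%:~R ^+ j * w l ^+ a * expR (w l * b%:R)
  = \sum_(q < a.+1) (ln a1 ^+ (a - q) * ln a2 ^+ q * phi (i + (a - q)) (j + q) b) *+ 'C(a, q).
  under eq_bigr => l _.
    rewrite {1}/w exprDn mulr_sumr mulr_suml; over.
  rewrite exchange_big; apply: eq_bigr => q _ /=.
  rewrite /phi mulr_sumr -sumrMnl; apply: eq_bigr => l _.
  rewrite [_ * (_ *+ 'C(_, _))]mulrnAr [_ *+ 'C(_, _) * _]mulrnAl; congr (_ *+ _); rewrite !exprMn !exprD; ring.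
rewrite exprDn mulr_suml; apply: le_trans (ler_norm_sum _ _ _) _.
apply: ler_sum => q _; have qa : (q <= a)%N by rewrite -ltnS.
rewrite normrMn [X in _ <= X]mulrnAl lerMn2r; apply/orP; right.
rewrite normrM; apply: ler_pM => //.
- rewrite normrM !normrX; apply: ler_pM; rewrite ?exprn_ge0 //.
  + by rewrite lerXn2r ?nnegrE // ltW.
  + by rewrite lerXn2r ?nnegrE // ltW.
- have ij' : (i + (a - q) + (j + q) <= 2 * S0)%N.
    by move: (2 * S0)%N ij qa => X; clear; lia.
  have := phi_err ij' br rt; rewrite H ?subr0 //.
  by move: qa; clear; lia.
Qed.

Let big4 : (4 * k0%:R + 16) * 4 <= tau.
Proof.
apply: le_trans tau_big; apply: ler_wpM2l; first by have := k00; lra.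
by rewrite J27 -{1}[4]expr1 ler_weXn2l // ler1n.
Qed.

(** One round: the range [2 * S'] is spent half on [(i, j)] and half on derivatives, which are tiny
    at the [n] old points. Interpolation with [T = n S'] nodes makes the values at [n t] points
    smaller than Liouville's bound, since the gain [T / 2], with [T >= n tau^13], beats losses of
    order [n tau^12]. *)
Let step S' n : (t ^ 13 <= S')%N -> (2 * S' <= S0)%N -> (t ^ 3 <= n)%N ->
  (n <= t ^ 30)%N ->
  (forall i j x, (i + j < 2 * S')%N -> (x < n)%N -> Aval i j x = 0) ->
  forall i j x, (i + j < S')%N -> (x < n * t)%N -> Aval i j x = 0.
Proof.
move=> hS1 hS2 hn1 hn2 H i j x ij xr; set r := (n * t)%N.
have t_gt0 : (0 < t)%N by rewrite -(ltr_nat R).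
have S'S0 : (S' <= S0)%N by apply: leq_trans hS2; rewrite leq_pmull.
have S02 : (S0 <= 2 * S0)%N by rewrite leq_pmull.
pose N : R := n%:R; pose s : R := S'%:R.
have s1 : tau ^+ 13 <= s by rewrite -natrX ler_nat.
have s2 : s <= tau ^+ 14.
  have h : s <= P * tau ^+ 13 by rewrite -S0E ler_nat.
  apply: le_trans h _; apply: scaled_power_le => //; apply: le_trans big2.
  by rewrite ler_peMl //; have := k00; have := P1; lra.
have n1 : tau ^+ 3 <= N by rewrite -natrX ler_nat.
have n2 : N <= tau ^+ 30 by rewrite -natrX ler_nat.
have tp k : 0 <= tau ^+ k by rewrite exprn_ge0 // ltW.
have N0 : 0 <= N by rewrite (le_trans _ n1).
have rE : r%:R = N * tau by rewrite natrM.
have rt : r%:R <= tau ^+ 31 by rewrite rE exprSr ler_wpM2r // ltW.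
have Nt a : N * tau ^+ a <= tau ^+ (30 + a) by rewrite exprD ler_wpM2r.
have WrE : W * r%:R = 4 * (N * tau ^+ 12).
  by rewrite rE /W [tau ^+ 12]exprS; ring.
have ZN : Z <= N * tau ^+ 12 by rewrite /Z -[15%N]/(3 + 12)%N exprD ler_wpM2r.
pose T := (n * S')%N; have TE : T%:R = N * s by rewrite natrM.
have T1 : N * tau ^+ 13 <= T%:R by rewrite TE ler_wpM2l.
have T2 : T%:R <= tau ^+ 44 by rewrite TE (_ : 44 = 30 + 14)%N // exprD ler_pM // (le_trans _ s1).
(* Bounds all derivatives at the nodes; of the smallness [expR (- tau ^+ 60)] of [Lam], at least
   [expR (- tau ^+ 59)] survives the other factors. *)
pose eps : R := (tau + tau) ^+ S0 * err r.
have tt1 : 1 <= tau + tau by have := tau1; lra.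
have r_gt0 : 0 < r%:R :> R by rewrite ltr0n (leq_ltn_trans _ xr).
have err_gt0 : 0 < err r.
  by rewrite /err !mulr_gt0 ?expR_gt0 // exprn_gt0.
have eps0 : 0 < eps by rewrite mulr_gt0 // exprn_gt0 // (lt_le_trans ltr01).
have err_eps : err r <= eps by rewrite ler_peMl // exprn_ege1.
have eps_le : eps <= expR (- tau ^+ 59).
  have h1 : (tau + tau) ^+ S0 <= expR Z.
    apply: (@le_trans _ _ (expR tau ^+ S0)).
      rewrite lerXn2r ?nnegrE ?expR_ge0 // ?(le_trans ler01) //.
      by have := @pe 1 isT; rewrite expr1; have := tau1; lra.
    rewrite -expRM_natr ler_expR S0E mulrCA -exprS.
    apply: scaled_power_le => //; apply: le_trans big2.
    by rewrite ler_peMl //; have := k00; have := P1; lra.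
  have h2 : 2 * (tau ^+ 10 * r%:R) <= expR tau.
    apply: le_trans (@pe 41 isT); have h : tau ^+ 10 * r%:R <= tau ^+ 41.
      by rewrite (_ : 41 = 10 + 31)%N // exprD ler_wpM2l.
    by have := tp 41%N; lra.
  apply: (@le_trans _ _ (expR Z * (expR (3 * Z) * (expR (W * r%:R) *
     (expR tau * expR (- tau ^+ 60)))))).
    apply: ler_pM => //; first by rewrite exprn_ge0 // (le_trans ler01).
    rewrite /err ler_pM2l ?expR_gt0 // ler_pM2l ?expR_gt0 // mulrA.
    by rewrite ler_pM2r ?expR_gt0.
  rewrite -!expRD ler_expR WrE.
  have g1 : Z <= tau ^+ 59 by rewrite pw1.
  have g2 : N * tau ^+ 12 <= tau ^+ 59 by apply: le_trans (Nt _) _; rewrite pw1.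
  have g3 : tau <= tau ^+ 59 by rewrite -{1}[tau]expr1 pw1.
  have g4 : 10 * tau ^+ 59 <= tau ^+ 60 by apply: pw => //; have := k00; lra.
  lra.
have hder b a : (b < n)%N -> (a < S')%N ->
  `|\sum_l (p l)%:~R * (u l)%:~R ^+ i * (v l)%:~R ^+ j * w l ^+ a * expR (w l * b%:R)|
   <= eps.
  move=> bn aS; have br : (b <= r)%N by rewrite (leq_trans (ltnW bn)) // leq_pmulr.
  apply: le_trans (phi_deriv (r := r) _ br rt _) _.
    apply: leq_trans (leq_trans hS2 S02); by move: ij aS; clear; lia.
    by move=> i' j' ij'; apply: H => //; move: ij ij' aS; clear; lia.
  rewrite ler_wpM2r ?err_ge0 // ler_weXn2l //.
  exact: leq_trans (ltnW aS) S'S0.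
have nr : (n <= r)%N by rewrite leq_pmulr.
have W0 : 0 <= W by rewrite /W mulr_ge0.
have := expsum_interpolation W0 w_le eps0 hder nr (ltnW xr).
rewrite -/T -/(phi i j x) => hphi.
have ijS : (i + j <= 2 * S0)%N.
  exact: leq_trans (ltnW ij) (leq_trans S'S0 S02).
have hA := phi_err ijS (ltnW xr) rt.
have F1 : (1 + T%:R *+ 2 * r%:R) ^+ T <= expR (tau ^+ 45).
  apply: (@le_trans _ _ (expR tau ^+ T)).
    rewrite lerXn2r ?nnegrE ?expR_ge0 //.
    apply: le_trans (@pe 75 isT).
    have h : T%:R * r%:R <= tau ^+ 75.
      by rewrite (_ : 75 = 44 + 31)%N // exprD ler_pM.
    have h1 : 1 <= tau ^+ 75 by rewrite exprn_ege1.
    by rewrite -mulr_natl -mulrA; lra.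
  by rewrite -expRM_natr ler_expR [tau ^+ 45]exprS ler_pM2l.
(* The inequality [y ^+ T / T! <= expR y] at [y = expR (1 / 2) * r * W] trades the factorial for
   [expR (- T / 2)]; [8] comes from [expR (1 / 2) <= 2] and [W r = 4 N tau^12]. *)
have F2 : (r%:R * W) ^+ T / T`!%:R <= expR (8 * (N * tau ^+ 12) - T%:R / 2).
  have h0 : 0 <= r%:R * W by rewrite mulr_ge0.
  have h1 := powerfact_le_expR T (y := expR (1 / 2) * (r%:R * W)).
  have {}h1 := h1 (mulr_ge0 (expR_ge0 _) h0).
  rewrite exprMn -expRM_natr in h1.
  have h2 : expR (1 / 2) <= 2 :> R.
    have g1 := expR_ge1Dx (- (1 / 2) : R); have g2 : expR (1 / 2) * expR (- (1 / 2)) = 1 :> R by rewrite expRxMexpNx_1.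
    by have g3 := expR_gt0 (1 / 2 : R); nra.
  have h3 : expR (expR (1 / 2) * (r%:R * W)) <= expR (8 * (N * tau ^+ 12)).
    rewrite ler_expR [r%:R * W]mulrC WrE.
    have : 0 <= N * tau ^+ 12 by rewrite mulr_ge0.
    nra.
  have h4 := le_trans h1 h3.
  rewrite expRB ler_pdivlMr ?expR_gt0 //; apply: le_trans h4.
  rewrite le_eqVlt; apply/orP; left; apply/eqP.
  have -> : T%:R / 2 = 1 / 2 * T%:R :> R by ring.
  by ring.
(* [expR (- K)] is Liouville's bound; [B1] and [B2] allot half of it to the errors at the nodes and
   half to the remainder. *)
pose K := k0%:R * (3 * Z + tau ^+ 11 * r%:R).
have KE : K = k0%:R * (3 * Z + N * tau ^+ 12).
  by rewrite /K rE [tau ^+ 12]exprSr; congr (_ * (_ + _)); ring.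
have K1 : K <= 4 * k0%:R * (N * tau ^+ 12).
  rewrite KE; have := k00; set y := N * _ in ZN *.
  have -> : 4 * k0%:R * y = k0%:R * (4 * y) by ring.
  by move=> ?; rewrite ler_wpM2l //; lra.
apply: (liou ijS (r := r%:R)); first by rewrite ler_nat.
rewrite -/K.
have y0 : tau ^+ 15 <= N * tau ^+ 12 := ZN.
have B1 : (expR (tau ^+ 45) *+ 2 + 1) * expR (- tau ^+ 59) + expR (- tau ^+ 59) <= expR (- K) / 2.
  have g0 : 1 <= expR (tau ^+ 45) by rewrite -expR0 ler_expR.
  have g1 : (expR (tau ^+ 45) *+ 2 + 1) * expR (- tau ^+ 59) + expR (- tau ^+ 59) <=
    4 * expR (tau ^+ 45) * expR (- tau ^+ 59).
    have := expR_gt0 (- tau ^+ 59); rewrite -mulr_natl => ?; nra.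
  apply: le_trans g1 _; rewrite ler_pdivlMr //.
  have g2 : 8 <= expR tau by have := @pe 1 isT; rewrite expr1; have := big4; have := k00; lra.
  apply: (@le_trans _ _ (expR tau * expR (tau ^+ 45) * expR (- tau ^+ 59))).
    have := expR_gt0 (tau ^+ 45); have := expR_gt0 (- tau ^+ 59) => e1 e2.
    have : 0 < expR (tau ^+ 45) * expR (- tau ^+ 59) by rewrite mulr_gt0.
    rewrite -[in X in _ -> X]mulrA -[X in _ -> _ <= X]mulrA => ?; nra.
  rewrite -!expRD ler_expR.
  have g3 : 4 * k0%:R * (N * tau ^+ 12) <= tau ^+ 43.
    apply: (@le_trans _ _ (4 * k0%:R * tau ^+ 42)); last by apply: pw => //; lra.
    by rewrite ler_wpM2l ?mulr_ge0 //; apply: Nt.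
  have g4 : tau ^+ 43 <= tau ^+ 45 by rewrite pw1.
  have g5 : tau <= tau ^+ 45 by rewrite -{1}[tau]expr1 pw1.
  have g6 : 3 * tau ^+ 45 <= tau ^+ 59 by apply: pw => //; have := k00; lra.
  lra.
have B2 : expR (3 * Z) * ((r%:R * W) ^+ T / T`!%:R * expR (W * r%:R)) < expR (- K) / 2.
  apply: (@le_lt_trans _ _ (expR (3 * Z) * (expR (8 * (N * tau ^+ 12) - T%:R / 2) * expR (W * r%:R)))).
    by rewrite ler_pM2l ?expR_gt0 // ler_pM2r ?expR_gt0.
  rewrite -!expRD ltr_pdivlMr //.
  have g2 : 2 < expR tau by have := @pe 1 isT; rewrite expr1; have := big4; have := k00; lra.
  apply: (@lt_le_trans _ _ (expR (3 * Z + (8 * (N * tau ^+ 12) - T%:R / 2 + W * r%:R)) * expR tau)).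
    by rewrite ltr_pM2l ?expR_gt0.
  rewrite -expRD ler_expR WrE.
  have g3 : tau <= tau ^+ 15 by rewrite -{1}[tau]expr1 pw1.
  have g4 : N * tau ^+ 13 = tau * (N * tau ^+ 12) by rewrite [tau ^+ 13]exprS; ring.
  (* Hence [T / 2 >= (8 k0 + 32) N tau^12], while the other exponents and [K] add up to at most
     [(4 k0 + 16) N tau^12]. *)
  have g5 : (4 * k0%:R + 16) * 4 * (N * tau ^+ 12) <= tau * (N * tau ^+ 12).
    by rewrite ler_wpM2r ?mulr_ge0.
  have k0y : 0 <= k0%:R * (N * tau ^+ 12) by rewrite !mulr_ge0.
  have y1 : 0 <= N * tau ^+ 12 by rewrite mulr_ge0.
  have K2 : K <= 4 * (k0%:R * (N * tau ^+ 12)) by apply: le_trans K1 _; lra.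
  have g6 : (4 * k0%:R + 16) * 4 * (N * tau ^+ 12) = 16 * (k0%:R * (N * tau ^+ 12)) + 64 * (N * tau ^+ 12) by ring.
  rewrite g6 in g5; rewrite g4 in T1.
  move: T1 K2 g5 k0y y1 y0; rewrite -/Z; set q := k0%:R * _; set y := N * _; set T' := T%:R; set z := tau * y.
  move: g3; rewrite -/Z; lra.
have hc := coef_le ijS.
have m0 : 0 <= (r%:R * W) ^+ T / T`!%:R * expR (W * r%:R).
  apply: mulr_ge0; last exact: expR_ge0.
  by apply: divr_ge0 => //; apply: exprn_ge0; apply: mulr_ge0.
have hm := le_lt_trans (ler_wpM2r m0 hc) B2.
have -> : Aval i j x = phi i j x - (phi i j x - Aval i j x) by ring.
apply: le_lt_trans (ler_normB _ _) _.
have F3 : ((1 + T%:R *+ 2 * r%:R) ^+ T *+ 2 + 1) * eps <=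
  (expR (tau ^+ 45) *+ 2 + 1) * expR (- tau ^+ 59).
  apply: ler_pM => //; last by rewrite lerD2r ler_wMn2r.
  exact: ltW.
have F4 := le_trans err_eps eps_le.
have Ehalf : expR (- K) = expR (- K) / 2 + expR (- K) / 2 by field.
rewrite Ehalf.
move: hphi hA hm F3 F4 B1.
lra.
Qed.

Let iterated_step : (forall i j x, (i + j < S0)%N -> (x < t ^ 3)%N -> Aval i j x = 0) ->
  forall k, (k <= J)%N -> forall i j x, (i + j < 2 ^ (J - k) * t ^ 13)%N ->
  (x < t ^ (3 + k))%N -> Aval i j x = 0.
Proof.
have t_gt0 : (0 < t)%N by rewrite -(ltr_nat R).
move=> H0; elim=> [|k IH] kJ; first by move=> i j x; rewrite subn0 addn0; apply: H0.
have E : (2 * (2 ^ (J - k.+1) * t ^ 13) = 2 ^ (J - k) * t ^ 13)%N.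
  by rewrite mulnA -expnS subnSK.
move=> i j x ij xk; apply: (step (S' := (2 ^ (J - k.+1) * t ^ 13)%N) (n := (t ^ (3 + k))%N)) => //.
- by rewrite leq_pmull // expn_gt0.
- by rewrite E leq_pmul2r ?expn_gt0 ?t_gt0 // leq_exp2l // leq_subr.
- by rewrite leq_pexp2l // leq_addr.
- by rewrite leq_pexp2l //; move: kJ; rewrite J27; clear; lia.
- by move=> i' j' x'; rewrite E; apply: IH; rewrite ltnW.
- by move: xk; rewrite addnS expnSr.
Qed.

Let coefficients_eq0 :
  (forall i j x, (i + j < S0)%N -> (x < t ^ 3)%N -> Aval i j x = 0) ->
  forall l, p l = 0.
Proof.
move=> H0 l0; have t_gt0 : (0 < t)%N by rewrite -(ltr_nat R).
have H := iterated_step H0 (leqnn J).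
apply: (@mulrIz R 1 (oner_neq0 _)); rewrite mulr0z.
apply: (separated_coefficient_eq0 (u := fun l => (u l)%:~R) (v := fun l => (v l)%:~R)
   (th := th) (S := (t ^ 13)%N) (n := (t ^ (3 + J))%N) (p := fun l => (p l)%:~R)).
- by move=> i j x ij; apply: H; rewrite subnn expn0 mul1n.
- by rewrite -(ler_nat R) cardI -natrX ler_nat leq_pexp2l // J27.
(* Within a fibre of [th] the exponent of [a3] determines the index, by [indep]; so a fibre has at
   most [L <= t ^ 13] elements. *)
- have inj : {in [pred l | th l == th l0] &, injective (fun l : I => l.2)}.
    move=> [[l1 l2] l3] [[m1 m2] m3]; rewrite !inE /th /= => /eqP h1 /eqP h2 e3.
    subst m3; have : a1 ^+ l1 * a2 ^+ l2 * a3 ^+ l3 = a1 ^+ m1 * a2 ^+ m2 * a3 ^+ l3.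
      by rewrite h1 h2.
    move=> /(mulIf _) h; have {h} : a1 ^+ l1 * a2 ^+ l2 = a1 ^+ m1 * a2 ^+ m2.
      by apply: h; rewrite expf_neq0 // gt_eqF.
    by case/indep => /val_inj -> /val_inj ->.
  rewrite -(card_in_image inj); apply: leq_trans (max_card _) _.
  by rewrite card_ord leq_pexp2l.
(* Equal [u] and [v] give equal [w]; then equal [th] forces equal [l3 Lam], and [Lam <> 0]
   identifies all three exponents. *)
- move=> l tl /intr_inj ul /intr_inj vl.
  have wl : w l = w l0 by rewrite /w ul vl.
  move: tl; rewrite !thE => /expR_inj; rewrite wl => /addrI /(mulIf Lam_neq0).
  move=> /eqP; rewrite eqr_nat => /eqP e3.
  move: ul vl e3; rewrite /u /v; case: l {wl} => [[l1 l2] l3]; case: l0 => [[m1 m2] m3] /=.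
  move=> ul vl /val_inj e3; subst m3.
  move/addIr: ul => [] /val_inj ->; by move/addIr: vl => [] /val_inj ->.
Qed.

(** Liouville's exponent on the initial range is at most [4 k0 Z], so values this small vanish, and
    the extrapolation can start. *)
Lemma small_values_coefficients_eq0 :
  (forall i j x, (i < S0)%N -> (j < S0)%N -> (x < t ^ 3)%N ->
     `|Aval i j x| <= expR (- ((4 * k0%:R + 1) * Z))) ->
  forall l, p l = 0.
Proof.
move=> H; apply: coefficients_eq0 => i j x ij xt.
have iS : (i < S0)%N by apply: leq_ltn_trans ij; rewrite leq_addr.
have jS : (j < S0)%N by apply: leq_ltn_trans ij; rewrite leq_addl.
have xt' : x.+1%:R <= tau ^+ 3 by rewrite -natrX ler_nat.
have ijS : (i + j <= 2 * S0)%N by rewrite (leq_trans (ltnW ij)) // leq_pmull.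
apply: (liou ijS xt'); apply: le_lt_trans (H i j x iS jS xt) _.
rewrite ltr_expR ltrN2 -exprD.
have h1 : tau ^+ (11 + 3) <= Z by rewrite pw1.
have h2 : 0 < Z by rewrite exprn_gt0.
apply: (@le_lt_trans _ _ (k0%:R * (4 * Z))).
  by rewrite ler_wpM2l //; lra.
by rewrite mulrA ltr_pM2r // mulrC ltrDl.
Qed.

End FixedCoefficients.

(** * Choice of the coefficients by the pigeonhole principle *)

Let value_le (i j x : nat) l : (i < S0)%N -> (j < S0)%N -> (x < t ^ 3)%N ->
  `|(u l)%:~R ^+ i * (v l)%:~R ^+ j * th l ^+ x| <= expR (2 * Z) :> R.
Proof.
move=> iS jS xt; rewrite normrM (_ : 2 * Z = Z + Z); last by ring.
have tp k : 0 <= tau ^+ k by rewrite exprn_ge0 // ltW.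
rewrite expRD; apply: ler_pM => //.
  by apply: uv_le; rewrite mul2n -addnn leq_add // ltnW.
rewrite thE -expRM_natr ger0_norm ?expR_ge0 // ler_expR.
apply: le_trans (ler_norm _) _; rewrite normrM normr_nat.
have h1 : `|w l + (l.2 : nat)%:R * Lam| <= 5 * tau ^+ 11.
  apply: le_trans (ler_normD _ _) _; have := w_le l; rewrite /W.
  have : `|(l.2 : nat)%:R * Lam| <= tau ^+ 10 * 1 by rewrite normrM normr_nat ler_pM.
  have : tau ^+ 10 <= tau ^+ 11 by rewrite pw1.
  lra.
have h2 : x%:R <= tau ^+ 3 by rewrite -natrX ler_nat ltnW.
apply: le_trans (ler_pM _ _ h1 h2) _ => //.
rewrite -mulrA -exprD; apply: pw => //; have := k00; lra.
Qed.

(** There are [P^2 tau^29] forms in [tau^30] unknowns, and the spare factor [tau] pays for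
    [(4 k0 + 5) P^2]. So suitable coefficients, not all zero, exist, while extrapolation makes all
    of them vanish. *)
Lemma small_linear_form_absurd : False.
Proof.
have t_gt0 : (0 < t)%N by rewrite -(ltr_nat R).
have tp k : 0 < tau ^+ k by rewrite exprn_gt0.
pose F : finType := ('I_S0 * 'I_S0 * 'I_(t ^ 3))%type.
pose a (f : F) (l : I) : R := (u l)%:~R ^+ f.1.1 * (v l)%:~R ^+ f.1.2 * th l ^+ f.2.
have aZ f l : `|a f l| <= expR (2 * Z) by apply: value_le.
pose Q := Num.truncn (expR Z).
have /andP[Q1 Q2] : Q%:R <= expR Z < Q.+1%:R by apply: truncn_itv; apply: expR_ge0.
have d0 := expR_gt0 (- ((4 * k0%:R + 1) * Z)).
have cardF : #|F|%:R = P ^+ 2 * tau ^+ 29 :> R.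
  rewrite 2!card_prod !card_ord 2!natrM S0E natrX -/tau.
  by rewrite (_ : 29 = 13 + 13 + 3)%N // !exprD; ring.
have card : (2 * #|I|%:R * Q%:R * expR (2 * Z) / expR (- ((4 * k0%:R + 1) * Z)) + 1) ^+ #|F|
   < Q.+1%:R ^+ #|I| :> R.
  have h1 : 2 * #|I|%:R * Q%:R * expR (2 * Z) / expR (- ((4 * k0%:R + 1) * Z)) + 1
     <= expR ((4 * k0%:R + 5) * Z).
    rewrite -expRN opprK cardI.
    have g1 : 2 * tau ^+ 30 * Q%:R * expR (2 * Z) * expR ((4 * k0%:R + 1) * Z) <=
      2 * tau ^+ 30 * expR ((4 * k0%:R + 4) * Z).
      have -> : (4 * k0%:R + 4) * Z = Z + 2 * Z + (4 * k0%:R + 1) * Z by ring.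
      rewrite (expRD (Z + 2 * Z)) (expRD Z) mulrA ler_wpM2r ?expR_ge0 // mulrA.
      by rewrite ler_wpM2r ?expR_ge0 // ler_wpM2l // mulr_ge0 // ltW.
    have g2 : 1 <= expR ((4 * k0%:R + 4) * Z).
      by rewrite -expR0 ler_expR mulr_ge0 ?(ltW (tp _)) //; have := k00; lra.
    have g3 : 3 * tau ^+ 30 <= expR Z.
      apply: le_trans (@pe 30 isT) _.
      by rewrite ler_expR -{1}[tau]expr1 pw1.
    have -> : (4 * k0%:R + 5) * Z = Z + (4 * k0%:R + 4) * Z by ring.
    have g4 : 1 <= tau ^+ 30 by rewrite exprn_ege1.
    rewrite [expR (Z + _)]expRD; apply: le_trans (ler_wpM2r (expR_ge0 _) g3).
    move: g1 g2 g4; set X := expR _; set Y := 2 * _ * _ * _ * _; set y := tau ^+ 30; nra.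
  apply: (@le_lt_trans _ _ (expR Z ^+ #|I|)).
    apply: (@le_trans _ _ (expR ((4 * k0%:R + 5) * Z) ^+ #|F|)).
      rewrite lerXn2r ?nnegrE ?expR_ge0 // addr_ge0 // divr_ge0 ?expR_ge0 //.
    rewrite -!expRM_natr ler_expR cardF cardI.
    have -> : (4 * k0%:R + 5) * Z * (P ^+ 2 * tau ^+ 29) = Z * ((4 * k0%:R + 5) * P ^+ 2 * tau ^+ 29) by ring.
    rewrite ler_pM2l ?tp //; apply: scaled_power_le => //; apply: le_trans big1.
    by rewrite ler_wpM2r ?exprn_ge0 // ?(le_trans ler01) //; have := k00; lra.
  rewrite ltrXn2r ?nnegrE ?expR_ge0 //; apply/negP => /eqP h.
  by have := tp 30%N; rewrite -cardI h ltxx.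
have [p [[l0 pl0] pQ pa]] := pigeonhole_forms d0 (expR_ge0 _) aZ card.
have p_le l : `|(p l)%:~R| <= expR Z :> R.
  apply: le_trans Q1; rewrite -intr_norm -natr_absz ler_nat; exact: pQ.
move/eqP: pl0; apply; apply: (small_values_coefficients_eq0 p_le) => i j x iS jS xt.
have := pa (Ordinal iS, Ordinal jS, Ordinal xt); rewrite /a /=.
by under eq_bigr do rewrite 2!mulrA.
Qed.

End BakerCore.

(** [C0] depends only on [a1], [a2] and [k0], because [a3] will vary with the unknown [l].
    Liouville's inequality is assumed for all [L] and used at [L = t ^ 10]. *)
Lemma log_form_lower_bound (R : realType) (a1 a2 : R) (k0 : nat) :
  0 < a1 -> 0 < a2 ->
  (forall i j i' j' : nat,
     a1 ^+ i * a2 ^+ j = a1 ^+ i' * a2 ^+ j' -> i = i' /\ j = j') ->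
  exists C0 : nat, forall (t : nat) (a3 : R) (b1 b2 : int), (C0 <= t)%N ->
  0 < a3 -> `|ln a3| <= t%:R ->
  `|b1%:~R| <= expR t%:R :> R -> `|b2%:~R| <= expR t%:R :> R ->
  (forall (L x : nat) (c : 'I_L * 'I_L * 'I_L -> int) (y : R),
     (0 < L)%N -> 0 <= y -> \sum_l `|(c l)%:~R| <= expR y ->
     let A : R := \sum_l (c l)%:~R * (a1 ^+ l.1.1 * a2 ^+ l.1.2 * a3 ^+ l.2) ^+ x in
     A != 0 -> expR (- (k0%:R * (y + t%:R * L%:R * x.+1%:R))) <= `|A|) ->
  ln a3 - b1%:~R * ln a1 - b2%:~R * ln a2 != 0 ->
  expR (- t%:R ^+ 60) < `|ln a3 - b1%:~R * ln a1 - b2%:~R * ln a2|.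
Proof.
move=> a10 a20 indep; pose J := 27%N.
have [Ce hCe] := expR_beats_power 80 (3 : R).
pose M : R := Num.max Ce (Num.max ((4 * k0%:R + 16) * 4 ^+ J) (Num.max `|ln a1| `|ln a2|)).
exists (Num.truncn M).+1 => t a3 b1 b2 Ct a30 l3 hb1 hb2 liou Lam0.
have Mt : M <= t%:R.
  apply: le_trans (ltW (truncnS_gt M)) _; by rewrite ler_nat.
move: Mt; rewrite !ge_max => /and4P[h1 h2 h3 h4].
rewrite ltNge; apply/negP => hL.
have t0 : (0 < t)%N by apply: leq_trans Ct.
apply: (@small_linear_form_absurd R a1 a2 a3 b1 b2 t k0 J) => //.
- by move=> x c y y0 hc; apply: liou => //; rewrite expn_gt0 t0.
- exact: hCe.
Qed.

(** * Liouville's inequality through integer matrices *)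

Section MatrixNorm.
Implicit Types (d m n : nat).

(** The sum of the absolute entries is chosen for being submultiplicative. *)
Definition nrm m n (M : 'M[int]_(m, n)) : nat := (\sum_i \sum_j `|M i j|)%N.

Lemma nrm_entry m n (M : 'M[int]_(m, n)) i j : (`|M i j| <= nrm M)%N.
Proof.
rewrite /nrm (bigD1 i) //= (bigD1 j) //= -addnA; exact: leq_addr.
Qed.

Lemma nrmD m n (A B : 'M[int]_(m, n)) : (nrm (A + B) <= nrm A + nrm B)%N.
Proof.
rewrite /nrm -big_split; apply: leq_sum => i _; rewrite /= -big_split.
by apply: leq_sum => j _; rewrite mxE /=; lia.
Qed.

Lemma nrmZ m n c (A : 'M[int]_(m, n)) : nrm (c *: A) = (`|c| * nrm A)%N.
Proof.
rewrite /nrm big_distrr; apply: eq_bigr => i _; rewrite big_distrr.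
by apply: eq_bigr => j _; rewrite mxE abszM.
Qed.

Lemma nrm0 m n : nrm (0 : 'M[int]_(m, n)) = 0%N.
Proof. by rewrite /nrm big1 // => i _; rewrite big1 // => j _; rewrite mxE. Qed.

Lemma nrm_sum (I : finType) m n (F : I -> 'M[int]_(m, n)) :
  (nrm (\sum_i F i) <= \sum_i nrm (F i))%N.
Proof.
elim/big_rec2: _ => [|i x y _ IH]; first by rewrite nrm0.
by apply: leq_trans (nrmD _ _) _; rewrite leq_add2l.
Qed.

Lemma absz_sum (I : finType) (F : I -> int) : (`|(\sum_i F i)%R| <= \sum_i `|F i|)%N.
Proof. by elim/big_rec2: _ => [|i x y _ IH] //; lia. Qed.

Lemma nrmM m n k (A : 'M[int]_(m, n)) (B : 'M[int]_(n, k)) :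
  (nrm (A *m B) <= nrm A * nrm B)%N.
Proof.
apply: (@leq_trans (\sum_i \sum_k0 \sum_j `|A i j| * `|B j k0|)%N).
  apply: leq_sum => i _; apply: leq_sum => k0 _; rewrite mxE.
  by apply: leq_trans (absz_sum _) _; apply: leq_sum => j _; rewrite abszM.
rewrite /nrm big_distrl; apply: leq_sum => i _ /=.
rewrite exchange_big big_distrl; apply: leq_sum => j _ /=.
rewrite -big_distrr /= leq_mul2l; apply/orP; right.
by rewrite [X in (_ <= X)%N](bigD1 j) //= leq_addr.
Qed.

Lemma nrm1 d : nrm (1%:M : 'M[int]_d) = d.
Proof.
rewrite /nrm (eq_bigr (fun=> 1%N)) => [|i _]; first by rewrite sum_nat_const card_ord muln1.
rewrite (bigD1 i) //= mxE eqxx big1 ?addn0 // => j ji.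
by rewrite mxE eq_sym (negbTE ji).
Qed.

Lemma leq_wexp2r m n k : (m <= n)%N -> (m ^ k <= n ^ k)%N.
Proof. by case: k => // k mn; rewrite leq_exp2r. Qed.

Lemma nrmX d (A : 'M[int]_d.+1) h k : (nrm A <= h)%N -> (nrm (A ^+ k) <= d.+1 * h ^ k)%N.
Proof.
move=> Ah; elim: k => [|k IH]; first by rewrite expr0 nrm1 expn0 muln1.
rewrite exprS -mulmxE; apply: leq_trans (nrmM _ _) _.
by rewrite expnS mulnCA leq_mul.
Qed.

Lemma absz_det_le d (A : 'M[int]_d) h : (forall i j, (`|A i j| <= h)%N) ->
  (`|\det A| <= d`! * h ^ d)%N.
Proof.
move=> Ah; apply: leq_trans (absz_sum _) _.
apply: (@leq_trans (\sum_(s : 'S_d) h ^ d)%N); last first.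
  by rewrite sum_nat_const card_Sn.
apply: leq_sum => s _; rewrite abszM abszX /= exp1n mul1n.
have -> : (h ^ d = \prod_(i < d) h)%N by rewrite prod_nat_const card_ord.
have -> : `|(\prod_i A i (s i))%R|%N = (\prod_i `|A i (s i)|)%N.
  by elim/big_rec2: _ => //= i x y _ <-; rewrite abszM.
by apply: leq_prod => i _.
Qed.

Lemma absz_adj_le d (A : 'M[int]_d.+1) i j : (`|\adj A i j| <= d`! * nrm A ^ d)%N.
Proof.
rewrite mxE /cofactor abszM abszX /= exp1n mul1n.
by apply: absz_det_le => a b; rewrite !mxE; apply: nrm_entry.
Qed.

End MatrixNorm.

Section Liouville.
Variables (R : realType) (d : nat) (v : 'cV[R]_d.+1).
Hypothesis v_free : forall w : 'rV[rat]_d.+1, map_mx ratr w *m v = 0 -> w = 0.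

(** [M] is the matrix of multiplication by [x] on the lattice spanned by the entries of [v];
    arithmetic of numbers becomes arithmetic of integer matrices. *)
Definition acts (M : 'M[int]_d.+1) (x : R) : Prop := map_mx intr M *m v = x *: v.

Lemma actsD M N x y : acts M x -> acts N y -> acts (M + N) (x + y).
Proof. by rewrite /acts => h1 h2; rewrite map_mxD mulmxDl h1 h2 scalerDl. Qed.

Lemma actsM M N x y : acts M x -> acts N y -> acts (M * N) (x * y).
Proof.
rewrite /acts => h1 h2; rewrite -mulmxE map_mxM -mulmxA h2 -scalemxAr h1.
by rewrite scalerA mulrC.
Qed.

Lemma actsZ M x (c : int) : acts M x -> acts (c *: M) (c%:~R * x).
Proof. by rewrite /acts => h; rewrite map_mxZ -scalemxAl h scalerA. Qed.

Lemma acts1 : acts 1 1.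
Proof. by rewrite /acts map_mx1 mul1mx scale1r. Qed.

Lemma actsX M x k : acts M x -> acts (M ^+ k) (x ^+ k).
Proof.
by move=> h; elim: k => [|k IH]; rewrite ?expr0 ?exprS; [exact: acts1 | exact: actsM].
Qed.

Lemma acts_sum (I : finType) (M : I -> 'M[int]_d.+1) (x : I -> R) :
  (forall i, acts (M i) (x i)) -> acts (\sum_i M i) (\sum_i x i).
Proof.
move=> h; elim/big_rec2: _ => [|i y N _ IH]; last exact: actsD.
by rewrite /acts map_mx0 mul0mx scale0r.
Qed.

Lemma v_neq0 : exists i, v i 0 != 0.
Proof.
apply: contrapT => h.
have v0 : v = 0.
  apply/matrixP => i j; rewrite ord1 mxE; apply/eqP/negPn/negP => hi.
  by apply: h; exists i.
have := v_free (w := const_mx 1); rewrite v0 mulmx0 => /(_ erefl) /matrixP /(_ 0 0).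
by rewrite !mxE => /eqP; rewrite oner_eq0.
Qed.

(** A left kernel vector [w] of [M] gives [x (w v) = w M v = 0], hence [w v = 0], against the
    rational independence of the entries of [v]. *)
Lemma acts_det_neq0 M x : acts M x -> x != 0 -> \det M != 0.
Proof.
move=> hM x0; apply/negP => /det0P [w w0 wM].
have /eqP := congr1 (fun A => map_mx (intr : int -> R) A *m v) wM.
rewrite map_mxM -mulmxA hM -scalemxAr map_mx0 mul0mx scaler_eq0 (negbTE x0) /=.
move=> /eqP wv; move/eqP: w0; apply.
have := v_free (w := map_mx intr w); rewrite -map_mx_comp.
have -> : map_mx ((ratr : rat -> R) \o intr) w = map_mx intr w.
  by apply/matrixP => i j; rewrite !mxE /= ratr_int.
move=> /(_ wv) /matrixP h; apply/matrixP => i j.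
by have := h i j; rewrite !mxE => /eqP; rewrite intr_eq0 => /eqP.
Qed.

(* Cramer's rule: [\det M *: v = x *: (\adj M *m v)] and [\det M] is a nonzero integer. *)
Lemma liouville_acts : exists k : nat, forall M x, acts M x -> x != 0 ->
  1 <= k%:R * `|x| * (nrm M)%:R ^+ d.
Proof.
have [i0 vi0] := v_neq0.
pose s := \sum_j `|v j 0| / `|v i0 0|.
have s0 : 0 <= s by apply: sumr_ge0 => j _; rewrite divr_ge0.
exists (Num.truncn (d`!%:R * s)).+1 => M x hM x0.
have D0 := acts_det_neq0 hM x0.
have E : (\det M)%:~R * v i0 0 = x * \sum_j (\adj M i0 j)%:~R * v j 0 :> R.
  have := congr1 (fun A => (map_mx (intr : int -> R) A *m v) i0 0) (mul_adj_mx M).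
  rewrite map_mxM -mulmxA hM map_scalar_mx mul_scalar_mx -scalemxAr !mxE => <-.
  by congr (_ * _); apply: eq_bigr => j _; rewrite !mxE.
have h1 : `|v i0 0| <= `|x| * (\sum_j (d`! * nrm M ^ d)%:R * `|v j 0|).
  apply: (@le_trans _ _ `|(\det M)%:~R * v i0 0|).
    rewrite normrM ler_peMl // -intr_norm -natr_absz ler1n absz_gt0 //.
  rewrite E normrM ler_wpM2l // (le_trans (ler_norm_sum _ _ _)) //.
  apply: ler_sum => j _; rewrite normrM ler_wpM2r // -intr_norm -natr_absz ler_nat.
  exact: absz_adj_le.
have h2 : 1 <= d`!%:R * s * `|x| * (nrm M)%:R ^+ d.
  rewrite -(ler_pM2r (x := `|v i0 0|)) ?normr_gt0 // mul1r; apply: le_trans h1 _.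
  rewrite -mulr_sumr /s -mulr_suml natrM natrX le_eqVlt; apply/orP; left; apply/eqP.
  by field; rewrite normr_eq0.
apply: le_trans h2 _; rewrite ler_wpM2r ?exprn_ge0 // ler_wpM2r //.
by apply: ltW; apply: truncnS_gt.
Qed.

(** A substitute for the height: [q] is a denominator of [x], and both [q] and the matrix of [q x]
    have size at most [h]. *)
Definition height_le (x : R) (h : nat) : Prop :=
  exists (q : nat) (M : 'M[int]_d.+1),
    [/\ (0 < q)%N, (q <= h)%N, (nrm M <= h)%N & acts M (q%:R * x)].

Lemma height_le_mono x h h' : (h <= h')%N -> height_le x h -> height_le x h'.
Proof.
by move=> hh [q [M [? ? ? ?]]]; exists q, M; split=> //; apply: leq_trans hh.
Qed.

(** Multiplying [A] by [(q1 q2 q3) ^+ (L * x)] clears all denominators, so the product is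
    represented by an integer matrix of controlled norm and [liouville_acts] applies. *)
Lemma liouville_polynomial : exists k0 : nat, forall (t : nat) (a1 a2 a3 : R) (h : nat),
  (0 < t)%N -> h%:R <= expR t%:R :> R ->
  height_le a1 h -> height_le a2 h -> height_le a3 h ->
  forall (L x : nat) (c : 'I_L * 'I_L * 'I_L -> int) (y : R),
     (0 < L)%N -> 0 <= y -> \sum_l `|(c l)%:~R| <= expR y ->
     let A : R := \sum_l (c l)%:~R * (a1 ^+ l.1.1 * a2 ^+ l.1.2 * a3 ^+ l.2) ^+ x in
     A != 0 -> expR (- (k0%:R * (y + t%:R * L%:R * x.+1%:R))) <= `|A|.
Proof.
have [k hk] := liouville_acts.
pose k1 := (k * d.+1 ^ (3 * d))%N.
exists (d + 3 * d.+1 + k1)%N => t a1 a2 a3 h t0 ht.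
move=> [q1 [M1 [q10 q1h n1 ac1]]] [q2 [M2 [q20 q2h n2 ac2]]] [q3 [M3 [q30 q3h n3 ac3]]].
move=> L x c y L0 y0 hc A A0.
(* The power of the common denominator that a term of lower degree still lacks. *)
pose e (i : 'I_L) := ((L - i) * x)%N.
pose N (l : 'I_L * 'I_L * 'I_L) : 'M[int]_d.+1 :=
  (c l * (q1 ^ e l.1.1 * q2 ^ e l.1.2 * q3 ^ e l.2)%N%:Z) *:
   (M1 ^+ (l.1.1 * x) * M2 ^+ (l.1.2 * x) * M3 ^+ (l.2 * x)).
pose q := (q1 * q2 * q3)%N.
have acN : acts (\sum_l N l) (q%:R ^+ (L * x) * A).
  rewrite /A mulr_sumr; apply: acts_sum => l.
  have := actsZ (c l * (q1 ^ e l.1.1 * q2 ^ e l.1.2 * q3 ^ e l.2)%N%:Z)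
    (actsM (actsM (actsX (l.1.1 * x) ac1) (actsX (l.1.2 * x) ac2)) (actsX (l.2 * x) ac3)).
  rewrite -/(N l); congr acts.
  have eE (i : 'I_L) (b : nat) : b%:R ^+ (L * x) = b%:R ^+ e i * b%:R ^+ (i * x) :> R.
    by rewrite -exprD /e -mulnDl subnK // ltnW.
  rewrite /q !natrM !exprMn (eE l.1.1 q1) (eE l.1.2 q2) (eE l.2 q3).
  rewrite rmorphM /= -pmulrn !natrM !natrX -!exprM; ring.
have h0 : (0 < h)%N by apply: leq_trans q1h.
have eL (i : 'I_L) : (e i + i * x = L * x)%N by rewrite /e -mulnDl subnK // ltnW.
have nN : (nrm (\sum_l N l) <= (\sum_l `|c l|) * (d.+1 ^ 3 * h ^ (3 * (L * x))))%N.
  apply: leq_trans (nrm_sum _) _; rewrite big_distrl /=; apply: leq_sum => l _.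
  rewrite nrmZ abszM -mulnA leq_mul2l; apply/orP; right => /=.
  apply: (@leq_trans ((h ^ e l.1.1 * h ^ e l.1.2 * h ^ e l.2) *
     ((d.+1 * h ^ (l.1.1 * x)) * (d.+1 * h ^ (l.1.2 * x)) * (d.+1 * h ^ (l.2 * x))))%N).
    apply: leq_mul; first by rewrite !leq_mul // leq_wexp2r.
    rewrite -!mulmxE; apply: leq_trans (nrmM _ _) _; apply: leq_mul; last exact: nrmX.
    by apply: leq_trans (nrmM _ _) _; apply: leq_mul; apply: nrmX.
  have -> : (3 * (L * x) = (e l.1.1 + l.1.1 * x) + (e l.1.2 + l.1.2 * x) + (e l.2 + l.2 * x))%N.
    by rewrite !eL; lia.
  rewrite !expnD; apply: eq_leq; rewrite (expnS _ 2) (expnS _ 1) expn1.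
  by move: (h ^ _)%N (h ^ _)%N (h ^ _)%N (h ^ _)%N (h ^ _)%N (h ^ _)%N => *; ring.
have qA : q%:R ^+ (L * x) * A != 0.
  by rewrite mulf_neq0 // expf_neq0 // pnatr_eq0 -lt0n !muln_gt0 q10 q20.
have := hk _ _ acN qA.
pose B : R := expR (t%:R * L%:R * x%:R).
have hB : h%:R ^+ (L * x) <= B.
  rewrite /B -mulrA -natrM expRM_natr lerXn2r ?nnegrE ?expR_ge0 //.
have B0 : 0 < B by apply: expR_gt0.
have B1 : 1 <= B by rewrite -expR0 ler_expR !mulr_ge0.
have hq : q%:R ^+ (L * x) <= B ^+ 3.
  apply: (@le_trans _ _ ((h%:R ^+ (L * x)) ^+ 3)); last first.
    by rewrite lerXn2r ?nnegrE ?exprn_ge0 // ltW.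
  rewrite exprAC -(natrX _ h) lerXn2r ?nnegrE // ler_nat /q.
  by rewrite (expnS _ 2) (expnS _ 1) expn1 mulnA !leq_mul.
have hN : (nrm (\sum_l N l))%:R <= expR y * (d.+1%:R ^+ 3 * B ^+ 3) :> R.
  apply: (@le_trans _ _ ((\sum_l `|c l|) * (d.+1 ^ 3 * h ^ (3 * (L * x))))%:R).
    by rewrite ler_nat.
  rewrite !natrM; apply: ler_pM => //.
    rewrite natr_sum; apply: le_trans hc; apply: ler_sum => l _.
    by rewrite natr_absz intr_norm.
  rewrite !natrX ler_wpM2l ?exprn_ge0 // mulnC exprM.
  by rewrite lerXn2r ?nnegrE ?exprn_ge0 // ltW.
rewrite normrM ger0_norm ?exprn_ge0 // => hmain.
have : 1 <= k%:R * (B ^+ 3 * `|A|) * (expR y * (d.+1%:R ^+ 3 * B ^+ 3)) ^+ d.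
  apply: le_trans hmain _; apply: ler_pM.
  - by rewrite !mulr_ge0 ?exprn_ge0.
  - by rewrite exprn_ge0.
  - by rewrite ler_wpM2l // ler_wpM2r.
  - by rewrite lerXn2r ?nnegrE // !mulr_ge0 ?expR_ge0 ?exprn_ge0 // ltW.
have -> : k%:R * (B ^+ 3 * `|A|) * (expR y * (d.+1%:R ^+ 3 * B ^+ 3)) ^+ d =
  k1%:R * expR y ^+ d * B ^+ (3 * d.+1) * `|A|.
  rewrite /k1 natrM natrX (exprM B) (exprS (B ^+ 3)) (exprM _ 3 d).
  move: (d.+1%:R ^+ 3 : R) (B ^+ 3) (expR y) => D3 B3 Y; rewrite !exprMn; ring.
move=> hfin.
have k1e : k1%:R <= expR (k1%:R * (t%:R * L%:R * x.+1%:R)) :> R.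
  have g1 : k1%:R <= k1%:R * (t%:R * L%:R * x.+1%:R) :> R.
    by rewrite -!natrM ler_nat leq_pmulr // !muln_gt0 t0 L0.
  by apply: le_trans g1 _; apply: le_trans (expR_ge1Dx _); rewrite lerDr.
have By : B <= expR (t%:R * L%:R * x.+1%:R).
  by rewrite ler_expR ler_wpM2l ?mulr_ge0 // ler_nat.
rewrite expRN -[X in X <= _]mul1r ler_pdivrMr ?expR_gt0 //.
apply: le_trans hfin _; rewrite mulrC ler_wpM2l //.
set T := t%:R * L%:R * x.+1%:R in k1e By *.
have T0 : 0 <= T by rewrite !mulr_ge0.
have -> : (d + 3 * d.+1 + k1)%:R * (y + T) = k1%:R * T + d%:R * y + (3 * d.+1)%:R * T
   + ((3 * d.+1)%:R * y + k1%:R * y + d%:R * T) by rewrite !natrD; ring.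
apply: (@le_trans _ _ (expR (k1%:R * T) * expR (d%:R * y) * expR ((3 * d.+1)%:R * T))).
  apply: ler_pM; rewrite ?mulr_ge0 ?exprn_ge0 ?expR_ge0 //.
  - apply: ler_pM; rewrite ?exprn_ge0 ?expR_ge0 //; first by rewrite expRM_natl.
  - by rewrite expRM_natl lerXn2r ?nnegrE ?expR_ge0.
rewrite -!expRD ler_expR lerDl !addr_ge0 // mulr_ge0 //.
Qed.

End Liouville.

(** * Simultaneous heights of algebraic numbers *)

Section StableFamilies.
Variable R : realType.

(** The family may be rationally dependent, so that products of stable families are again stable;
    independence comes later, from minimality. *)
Definition stable_family (T : finType) (v : T -> R) (x : R) : Prop :=
  forall a, exists c : T -> rat, x * v a = \sum_b ratr (c b) * v b.

(** Multiplication by [x] shifts the powers, and the annihilating polynomial rewrites the one that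
    leaves the range. *)
Lemma powers_stable_family (x : R) : algebraicOver (ratr : rat -> R) x ->
  exists n, stable_family (fun i : 'I_n.+1 => x ^+ i) x.
Proof.
case=> p p0 /rootP px; have [sp|sp] := leqP (size p) 1.
  move: p0 px; rewrite (size1_polyC sp) map_polyC hornerC polyC_eq0 => c0 /= /eqP.
  by rewrite fmorph_eq0 (negbTE c0).
have [n En] : exists n, size p = n.+2 by exists (size p).-2; lia.
exists n => a; have [an|an] := ltnP a.+1 n.+1.
  exists (fun b => (b == Ordinal an)%:R); rewrite (bigD1 (Ordinal an)) //= eqxx.
  rewrite rmorph1 mul1r exprS big1 ?addr0 // => b /negbTE ->.
  by rewrite rmorph0 mul0r.
exists (fun b : 'I_n.+1 => - (p`_b / p`_n.+1)).
have lc0 : p`_n.+1 != 0 by have := p0; rewrite -lead_coef_eq0 lead_coefE En.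
have Ea : (a : nat) = n by apply/eqP; rewrite eqn_leq -ltnS ltn_ord -ltnS an.
move: px; rewrite (@horner_coef_wide _ n.+2) ?size_map_poly ?En // big_ord_recr /= coef_map /=.
move=> /eqP; rewrite addrC addr_eq0 => /eqP h.
have lr0 : ratr p`_n.+1 != 0 :> R by rewrite fmorph_eq0.
rewrite Ea -exprS; apply: (mulfI lr0); rewrite h mulr_sumr -sumrN.
apply: eq_bigr => i _; rewrite coef_map /= rmorphN fmorph_div /=.
by field.
Qed.

Lemma stable_family_prod (T S : finType) (v : T -> R) (w : S -> R) (x : R) :
  stable_family v x -> stable_family (fun ts : T * S => v ts.1 * w ts.2) x.
Proof.
move=> h [a s]; have [c hc] := h a.
exists (fun b : T * S => c b.1 * (b.2 == s)%:R); rewrite /= mulrA hc mulr_suml.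
rewrite (eq_bigr (fun b : T * S => (fun t u => ratr (c t * (u == s)%:R) * (v t * w u)) b.1 b.2)) //.
rewrite -(pair_bigA _ (fun t u => ratr (c t * (u == s)%:R) * (v t * w u))) /=.
apply: eq_bigr => t _; rewrite (bigD1 s) //= big1 ?addr0 => [|u /negbTE ->].
  by rewrite eqxx mulr1 mulrA.
by rewrite mulr0 rmorph0 mul0r.
Qed.

Lemma stable_family_prodr (T S : finType) (v : T -> R) (w : S -> R) (x : R) :
  stable_family w x -> stable_family (fun ts : T * S => v ts.1 * w ts.2) x.
Proof.
move=> h [t s]; have [c hc] := h s.
exists (fun b : T * S => c b.2 * (b.1 == t)%:R); rewrite /= mulrCA hc mulr_sumr.
rewrite (eq_bigr (fun b : T * S => (fun t' u => ratr (c u * (t' == t)%:R) * (v t' * w u)) b.1 b.2)) //.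
rewrite -(pair_bigA _ (fun t' u => ratr (c u * (t' == t)%:R) * (v t' * w u))) /=.
rewrite (bigD1 t) //= [X in _ + X]big1 ?addr0 => [|t' /negbTE ->].
  by apply: eq_bigr => u _; rewrite eqxx mulr1 mulrCA.
by rewrite big1 // => u _; rewrite mulr0 rmorph0 mul0r.
Qed.

Lemma algebraic_stable_family (s : seq R) :
  (forall x, x \in s -> algebraicOver (ratr : rat -> R) x) ->
  exists (T : finType) (v : T -> R), (exists a, v a != 0) /\
    forall x, x \in s -> stable_family v x.
Proof.
elim: s => [|y s IH] hs.
  by exists unit, (fun=> 1); split; [exists tt; rewrite oner_neq0 | move=> x; rewrite in_nil].
have [|T [v [[a va] hv]]] := IH; first by move=> x xs; apply: hs; rewrite inE xs orbT.
have [n hn] := powers_stable_family (hs y (mem_head _ _)).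
exists (T * 'I_n.+1)%type, (fun ts : T * 'I_n.+1 => v ts.1 * y ^+ ts.2); split.
  by exists (a, ord0); rewrite /= expr0 mulr1.
move=> x; rewrite inE => /orP[/eqP ->|xs].
  exact: (stable_family_prodr v hn).
by apply: (stable_family_prod (fun i : 'I_n.+1 => y ^+ i)); apply: hv.
Qed.

Definition stable_dim (s : seq R) (n : nat) : Prop :=
  exists v : 'cV[R]_n, v != 0 /\
    forall x, x \in s -> exists N : 'M[rat]_n, map_mx ratr N *m v = x *: v.

Lemma algebraic_stable_dim (s : seq R) :
  (forall x, x \in s -> algebraicOver (ratr : rat -> R) x) ->
  exists n, stable_dim s n.
Proof.
move=> /algebraic_stable_family[T [v [[a va] hv]]].
exists #|T|, (\col_i v (enum_val i)); split.
  apply/negP => /eqP /colP /(_ (enum_rank a)); rewrite !mxE enum_rankK => h.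
  by rewrite h eqxx in va.
move=> x /hv h; have /choice[c hc] : forall i : 'I_#|T|, exists c : T -> rat,
   x * v (enum_val i) = \sum_b ratr (c b) * v b by move=> i; apply: h.
exists (\matrix_(i, j) c i (enum_val j)); apply/colP => i; rewrite !mxE hc.
rewrite (reindex (J := 'I_#|T|) (@enum_val T T)) /=; last by apply: onW_bij; apply: enum_val_bij.
by apply: eq_bigr => j _; rewrite !mxE.
Qed.

(* A stable vector of minimal length has rationally independent entries: a relation
   would let us drop one of them. *)
Lemma algebraic_free_stable (s : seq R) :
  (forall x, x \in s -> algebraicOver (ratr : rat -> R) x) ->
  exists (d : nat) (v : 'cV[R]_d.+1),
    (forall w : 'rV[rat]_d.+1, map_mx ratr w *m v = 0 -> w = 0) /\
    forall x, x \in s -> exists N : 'M[rat]_d.+1, map_mx ratr N *m v = x *: v.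
Proof.
move=> /algebraic_stable_dim[n0 hn0].
have ex : exists n, (fun n => `[< stable_dim s n >]) n by exists n0; apply/asboolP.
case: (ex_minnP ex) => -[|d] /asboolP[v [v0 hv]] dmin.
  by move/eqP: v0; case; apply/colP => -[].
exists d, v; split=> // w wv; apply/eqP/negPn/negP => w0.
have [i0 wi0] : exists i, w 0 i != 0.
  apply: contrapT => h; move/eqP: w0; apply; apply/rowP => i; rewrite mxE.
  by apply/eqP/negPn/negP => hi; apply: h; exists i.
have /dmin : `[< stable_dim s d >]; last by rewrite ltnn.
apply/asboolP.
(* [F] deletes the entry [i0] and [E] restores it through the relation [w], so [F N E] multiplies
   the shorter vector by [x]. *)
pose E : 'M[rat]_(d.+1, d) := \matrix_(i, j)
  if unlift i0 i is Some k then (k == j)%:R else - (w 0 (lift i0 j) / w 0 i0).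
pose F : 'M[rat]_(d, d.+1) := row' i0 1%:M.
have Fv : map_mx ratr F *m v = row' i0 v.
  apply/colP => k; rewrite !mxE (bigD1 (lift i0 k)) //= big1 => [|j jk].
    by rewrite !mxE eqxx rmorph1 mul1r addr0.
  by rewrite !mxE eq_sym (negbTE jk) rmorph0 mul0r.
have Ev : map_mx ratr E *m row' i0 v = v.
  apply/colP => i; rewrite !mxE; case: (unliftP i0 i) => [k|] Ei.
    rewrite (bigD1 k) //= big1 => [|j jk].
      by rewrite !mxE Ei liftK eqxx rmorph1 mul1r addr0.
    by rewrite !mxE Ei liftK eq_sym (negbTE jk) rmorph0 mul0r.
  have wr0 : ratr (w 0 i0) != 0 :> R by rewrite fmorph_eq0.
  apply: (mulfI wr0).
  have /colP/(_ 0) := wv; rewrite !mxE (bigD1_ord i0) //= !mxE Ei => /eqP.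
  rewrite addr_eq0 => /eqP ->; rewrite mulr_sumr -sumrN; apply: eq_bigr => j _.
  by rewrite !mxE unlift_none rmorphN fmorph_div /=; field.
exists (row' i0 v); split.
  by apply: contraNneq v0 => h; rewrite -Ev h mulmx0.
move=> x /hv[N hN]; exists (F *m N *m E).
by rewrite !map_mxM -!mulmxA Ev hN -scalemxAr Fv.
Qed.

Lemma common_denominator d (N : 'M[rat]_d) :
  exists (q : nat) (M : 'M[int]_d), (0 < q)%N /\ q%:R *: N = map_mx intr M.
Proof.
pose q := (\prod_(i : 'I_d) \prod_(j : 'I_d) `|denq (N i j)|)%N.
exists q, (\matrix_(i, j) numq (q%:R * N i j)); split.
  by apply: prodn_gt0 => i; apply: prodn_gt0 => j; rewrite absz_gt0 denq_neq0.
apply/matrixP => i j; rewrite !mxE; apply/esym.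
have /dvdnP[k qk] : (`|denq (N i j)|%N %| q)%N.
  by rewrite /q (bigD1 i) //= (bigD1 j) //= -mulnA dvdn_mulr.
have E : q%:R * N i j = (k%:Z * numq (N i j))%:~R.
  rewrite qk -[X in _ * X = _]divq_num_den natrM natr_absz gtr0_norm ?denq_gt0 //.
  rewrite rmorphM /= -mulrA; congr (_ * _); rewrite mulrC divfK //.
  by rewrite intr_eq0 denq_neq0.
by rewrite E numq_int.
Qed.

Lemma algebraic_heights (s : seq R) :
  (forall x, x \in s -> algebraicOver (ratr : rat -> R) x) ->
  exists (d : nat) (v : 'cV[R]_d.+1),
    (forall w : 'rV[rat]_d.+1, map_mx ratr w *m v = 0 -> w = 0) /\
    exists h, forall x, x \in s -> height_le v x h.
Proof.
move=> /algebraic_free_stable[d [v [vfree hv]]]; exists d, v; split=> //.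
have ex x : x \in s -> exists h, height_le v x h.
  move=> /hv[N hN]; have [q [M [q0 qM]]] := common_denominator N.
  exists (maxn q (nrm M)), q, M; split=> //; rewrite ?leq_maxl ?leq_maxr //.
  rewrite /acts -[map_mx intr M](_ : map_mx (ratr \o intr) M = _); last first.
    by apply/matrixP => i j; rewrite !mxE /= ratr_int.
  by rewrite map_mx_comp -qM map_mxZ rmorph_nat -scalemxAl hN scalerA.
elim: s ex {hv} => [|y s IH] ex; first by exists 0%N => x; rewrite in_nil.
have [|h1 H1] := IH; first by move=> x xs; apply: ex; rewrite inE xs orbT.
have [h2 H2] := ex y (mem_head _ _).
exists (maxn h1 h2) => x; rewrite inE => /orP[/eqP ->|xs].
  exact: height_le_mono (leq_maxr _ _) H2.
exact: height_le_mono (leq_maxl _ _) (H1 x xs).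
Qed.

End StableFamilies.

(** * Powers of the dominant root lie outside the base field *)

(** Over [C] the gcd of [f] and [p] is a constant times [('X - z) ^+ n.+1]. The quotient of its two
    top coefficients, which lie in [F], is [- n.+1 z], and characteristic zero allows division by
    [n.+1]. *)
Lemma sole_common_root_in_base (F : fieldType) (C : closedFieldType)
    (iota : {rmorphism F -> C}) (f p : {poly F}) (z : C) :
  (forall n, n.+1%:R != 0 :> F) -> p != 0 ->
  root (map_poly iota f) z -> root (map_poly iota p) z ->
  (forall y, root (map_poly iota f) y -> root (map_poly iota p) y -> y = z) ->
  exists x, iota x = z.
Proof.
move=> char0 p0 fz pz uniq; pose g := gcdp f p.
have rg y : root (map_poly iota g) y = root (map_poly iota f) y && root (map_poly iota p) y.
  by rewrite /g gcdp_map root_gcd.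
have [r Er] := closed_field_poly_normal (map_poly iota g).
have g0 : g != 0 by rewrite gcdp_eq0 negb_and p0 orbT.
have lg0 : lead_coef g != 0 by rewrite lead_coef_eq0.
have rz y : y \in r -> y = z.
  move=> yr; have : root (map_poly iota g) y.
    by rewrite Er rootZ ?lead_coef_map ?fmorph_eq0 // root_prod_XsubC.
  by rewrite rg => /andP[]; apply: uniq.
have zr : z \in r.
  have : root (map_poly iota g) z by rewrite rg fz.
  by rewrite Er rootZ ?lead_coef_map ?fmorph_eq0 // root_prod_XsubC.
have s0 : size r != 0%N by rewrite size_eq0; apply: contraTneq zr => ->.
pose n := (size r).-1; have En : size r = n.+1 by rewrite prednK // lt0n.
have sum_r : \sum_(y <- r) y = n.+1%:R * z.
  rewrite -En big_seq (eq_bigr (fun=> z)) => [|y /rz //].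
  by rewrite -big_seq big_const_seq count_predT iter_addr_0 mulr_natl.
have := congr1 (fun q : {poly C} => q`_n) Er.
rewrite coefZ coefPn_prod_XsubC // sum_r coef_map lead_coef_map /= => h.
have nC : n.+1%:R != 0 :> C by rewrite -(rmorph_nat iota) fmorph_eq0.
have lC : iota (lead_coef g) != 0 by rewrite fmorph_eq0.
exists (- (g`_n / (n.+1%:R * lead_coef g))).
rewrite rmorphN fmorph_div rmorphM rmorph_nat h; field.
by rewrite lC nat1r nC.
Qed.

Lemma power_notin_base (R : realType) (K : fieldExtType rat)
    (iota : {rmorphism K -> complex R}) (f : {poly K}) (z1 z2 z3 : complex R) :
  (forall z, root (map_poly iota f) z <-> [\/ z = z1, z = z2 | z = z3]) ->
  1 < z1 -> `|z2| <= 1 -> `|z3| <= 1 -> ~ (exists x : K, iota x = z1) ->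
  forall a x, (0 < a)%N -> iota x <> z1 ^+ a.
Proof.
move=> roots z1gt z2le z3le notin a x a0 xz; apply: notin.
apply: (@sole_common_root_in_base _ _ iota f ('X^a - x%:P)).
- by move=> n; rewrite -scaler_nat scaler_eq0 negb_or oner_eq0 pnatr_eq0.
- by rewrite -size_poly_gt0 size_XnsubC.
- by apply/roots; constructor 1.
- by rewrite rmorphB /= map_polyXn map_polyC /= xz /root !hornerE subrr.
move=> y /roots hy; rewrite rmorphB /= map_polyXn map_polyC /= xz /root !hornerE subr_eq0.
move=> /eqP ya; have ny : `|y| ^+ a = z1 ^+ a.
  by rewrite -normrX ya normrX ger0_norm // ltW // (lt_trans ltr01).
have z1a : 1 < z1 ^+ a by rewrite exprn_egt1 // -lt0n.
have small w : `|w| <= 1 -> y <> w.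
  move=> w1 yw; have := lt_le_trans z1a (y := z1 ^+ a) (z := 1).
  by rewrite -{1}ny yw exprn_ile1 // ltxx => /(_ isT).
by case: hy => // h; case: (small _ _ h).
Qed.

(** * The real equation *)

(** With [D], [d] and [h] fixed, the logarithm of this height bound is of order [l.+1]; such numbers
    are the third argument of both linear forms. *)
Lemma height_le_affine_power (R : realType) d (v : 'cV[R]_d.+1) (g b : R) (h D l n : nat) (e : int) :
  height_le v g h -> height_le v b h -> (n <= D)%N -> (`|e| <= D)%N ->
  height_le v (g * (n%:R * b ^+ l - e%:~R)) ((2 * D.+1 * d.+1 * h) ^ l.+1).
Proof.
move=> [q1 [M1 [q10 q1h n1 ac1]]] [q2 [M2 [q20 q2h n2 ac2]]] nD eD.
have h0 : (0 < h)%N by apply: leq_trans q1h.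
have q2l : (q2 ^ l <= h ^ l)%N by apply: leq_wexp2r.
have big : (2 * D.+1 * d.+1 * h ^ l.+1 <= (2 * D.+1 * d.+1 * h) ^ l.+1)%N.
  by rewrite expnMn leq_mul2r; apply/orP; right; rewrite -[X in (X <= _)%N]expn1 leq_pexp2l.
exists (q1 * q2 ^ l)%N, (M1 * (n%:Z *: M2 ^+ l - (e * (q2 ^ l)%N%:Z) *: 1)); split.
- by rewrite muln_gt0 q10 expn_gt0 q20.
- apply: leq_trans big; rewrite expnS; apply: leq_trans (leq_mul q1h q2l) _.
  by rewrite leq_pmull.
- apply: leq_trans big; rewrite -mulmxE; apply: leq_trans (nrmM _ _) _.
  apply: (@leq_trans (h * (D * (d.+1 * h ^ l) + D * h ^ l * d.+1))%N).
    apply: leq_mul => //; apply: leq_trans (nrmD _ _) _; apply: leq_add.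
      by rewrite nrmZ leq_mul // nrmX.
    by rewrite -scaleNr nrmZ nrm1 abszN abszM leq_mul // leq_mul.
  rewrite expnS; move: (h ^ l)%N => X; nia.
- have := actsM ac1 (actsD (actsZ n%:Z (actsX l ac2)) (actsZ (- (e * (q2 ^ l)%N%:Z)) (acts1 v))).
  rewrite scaleNr; congr acts.
  rewrite rmorphN rmorphM /= -!pmulrn natrM natrX exprMn; ring.
Qed.

(** Both linear forms are instances: [l = 0], [e = 0] for the leading term alone, general [l] for
    the two leading terms. The condition on [t] reflects a logarithmic height of order [l.+1]; the
    bound [Num.min 1 (b - 1)] keeps the logarithm of the affine factor from being too negative. *)
Lemma affine_power_log_bound (R : realType) (a b z : R) (D : nat) :
  0 < a -> 1 < b -> 1 < z ->
  algebraicOver (ratr : rat -> R) a -> algebraicOver (ratr : rat -> R) b ->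
  algebraicOver (ratr : rat -> R) z ->
  (forall i j i' j' : nat, z ^+ i * b ^+ j = z ^+ i' * b ^+ j' -> i = i' /\ j = j') ->
  exists T0 : nat, forall (t l M n d : nat) (e : int), (T0 * l.+1 <= t)%N ->
  n%:R <= expR t%:R :> R -> M%:R <= expR t%:R :> R ->
  (d <= D)%N -> (`|e| <= D)%N ->
  Num.min 1 (b - 1) <= d%:R * b ^+ l - e%:~R ->
  a * z ^+ n * (b - 1) <> (d%:R * b ^+ l - e%:~R) * b ^+ M ->
  expR (- t%:R ^+ 60) <
  `|ln ((a * (b - 1))^-1 * (d%:R * b ^+ l - e%:~R)) - n%:R * ln z + M%:R * ln b|.
Proof.
move=> a0 b1 z1 alga algb algz indep.
have b0 : 0 < b by apply: lt_trans b1.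
have z0 : 0 < z by apply: lt_trans z1.
have bb : 0 < b - 1 by rewrite subr_gt0.
pose g := (a * (b - 1))^-1; have g0 : 0 < g by rewrite invr_gt0 mulr_gt0.
have algg : algebraicOver (ratr : rat -> R) g.
  by apply: algebraic_inv; apply: algebraic_mul => //; apply: algebraic_sub => //; apply: algebraic1.
have [|d0 [v [vfree [h hh]]]] := @algebraic_heights R [:: z; b; g].
  by move=> x; rewrite !inE => /or3P[] /eqP ->.
have hz := hh z (mem_head _ _).
have hb : height_le v b h by apply: hh; rewrite !inE eqxx orbT.
have hg : height_le v g h by apply: hh; rewrite !inE eqxx !orbT.
have [k0 hk0] := liouville_polynomial vfree.
have [C0 hC0] := log_form_lower_bound k0 z0 b0 indep.
pose H := (2 * D.+1 * d0.+1 * h)%N.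
pose e0 := Num.min 1 (b - 1).
have e00 : 0 < e0 by rewrite lt_min ltr01.
pose W : R := `|ln g| + `|ln e0| + ln (2 * D.+1%:R) + ln b.
have lnD : 0 <= ln (2 * D.+1%:R : R).
  by apply: ln_ge0; rewrite -natrM ler1n.
have lnb : 0 < ln b by apply: ln_gt0.
(* [C0] is the threshold for three logarithms, [H] makes [expR t] exceed the height bound, and [W]
   makes [t] exceed [|ln (g * y)|]. *)
exists (C0 + H + (Num.truncn W).+1).+1 => t l M n d e Tt nt Mt dD eD ey neq.
set y := d%:R * b ^+ l - e%:~R in ey neq *.
have y0 : 0 < y by apply: lt_le_trans ey.
have bl : 1 <= b ^+ l by rewrite exprn_ege1 // ltW.
have key k : (k <= (C0 + H + (Num.truncn W).+1).+1)%N -> (k * l.+1 <= t)%N.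
  by move=> kX; apply: leq_trans Tt; rewrite leq_mul2r kX orbT.
have keyW : ((Num.truncn W).+1 * l.+1 <= t)%N by apply: key; rewrite leqW // leq_addl.
have keyH : (H * l.+1 <= t)%N by apply: key; rewrite leqW // addnAC leq_addl.
have Ct : (C0 <= t)%N.
  by apply: (@leq_trans (C0 * l.+1)); [rewrite leq_pmulr | apply: key; rewrite leqW // -addnA leq_addr].
have t0 : (0 < t)%N by apply: leq_trans Tt; rewrite muln_gt0.
have h0 : (0 < h)%N by case: hz => q [? [q0 qh _ _]]; apply: leq_trans qh.
have H1 : (0 < H)%N by rewrite !muln_gt0 h0.
have Ht : (H ^ l.+1)%:R <= expR t%:R :> R.
  rewrite natrX; apply: (@le_trans _ _ (expR H%:R ^+ l.+1)).
    by rewrite lerXn2r ?nnegrE ?expR_ge0 // (le_trans _ (expR_ge1Dx _)) // lerDr.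
  by rewrite -expRM_natr ler_expR -natrM ler_nat.
have hH : (h <= H ^ l.+1)%N.
  rewrite (leq_trans (n := H)) //; first by rewrite /H leq_pmull.
  by rewrite -[X in (X <= _)%N]expn1 leq_pexp2l.
have ly : `|ln y| <= `|ln e0| + ln (2 * D.+1%:R) + l%:R * ln b.
  have up : ln y <= ln (2 * D.+1%:R) + l%:R * ln b.
    have -> : ln (2 * D.+1%:R) + l%:R * ln b = ln (2 * D.+1%:R * b ^+ l).
      by rewrite [ln (_ * b ^+ l)]lnM ?posrE ?mulr_gt0 ?exprn_gt0 // lnXn // -[ln b *+ l]mulr_natl.
    rewrite ler_ln ?posrE ?mulr_gt0 ?exprn_gt0 // /y.
    have h1 : d%:R <= D.+1%:R :> R by rewrite ler_nat ltnW.
    have h2 : - e%:~R <= D.+1%:R :> R.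
      apply: le_trans (ler_norm _) _; rewrite normrN -intr_norm -natr_absz ler_nat ltnW //.
    have h3 : D.+1%:R <= D.+1%:R * b ^+ l by rewrite ler_peMr.
    have h4 : d%:R * b ^+ l <= D.+1%:R * b ^+ l by rewrite ler_wpM2r // (le_trans ler01).
    by rewrite -mulrA; lra.
  have down : - `|ln e0| <= ln y.
    apply: (@le_trans _ _ (ln e0)); last by rewrite ler_ln ?posrE.
    by rewrite lerNl -normrN ler_norm.
  have : 0 <= `|ln e0| by [].
  have : 0 <= l%:R * ln b by rewrite mulr_ge0 // ltW.
  move=> *; rewrite ler_norml; apply/andP; split; lra.
have gy : 0 < g * y by rewrite mulr_gt0.
have l3 : `|ln (g * y)| <= t%:R.
  rewrite lnM ?posrE //; apply: le_trans (ler_normD _ _) _.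
  apply: (@le_trans _ _ (W * l.+1%:R)).
    apply: le_trans (lerD (lexx _) ly) _; rewrite /W -natr1.
    have : 0 <= l%:R :> R by [].
    have : 0 <= `|ln g| by []. have : 0 <= `|ln e0| by [].
    nra.
  apply: (@le_trans _ _ ((Num.truncn W).+1%:R * l.+1%:R)).
    by rewrite ler_wpM2r // ltW // truncnS_gt.
  by rewrite -natrM ler_nat.
have -> : ln (g * y) - n%:R * ln z + M%:R * ln b =
   ln (g * y) - (n%:Z)%:~R * ln z - (- M%:Z)%:~R * ln b.
  by rewrite rmorphN /= -!pmulrn; ring.
apply: (hC0 t (g * y) n%:Z (- M%:Z)) => //.
- by rewrite -pmulrn normr_nat.
- by rewrite rmorphN /= normrN -pmulrn normr_nat.
- apply: (hk0 t z b (g * y) (H ^ l.+1)%N) => //.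
  + exact: height_le_mono hz.
  + exact: height_le_mono hb.
  + exact: height_le_affine_power.
(* A vanishing form exponentiates to the excluded equation. *)
- apply/negP => /eqP; rewrite rmorphN /= -!pmulrn => hL.
  have E : ln (g * y * b ^+ M) = ln (z ^+ n).
    rewrite [ln (_ * b ^+ M)]lnM ?posrE ?exprn_gt0 // !lnXn // -[ln b *+ M]mulr_natl -[ln z *+ n]mulr_natl.
    by apply/eqP; rewrite -subr_eq0 -hL; apply/eqP; ring.
  have {}E : g * y * b ^+ M = z ^+ n by apply: ln_inj E; rewrite posrE ?mulr_gt0 ?exprn_gt0.
  apply: neq; rewrite -E /g; field.
  by rewrite !gt_eqF.
Qed.

Lemma geometric_range (R : comNzRingType) (b : R) (p q : nat) : (p <= q)%N ->
  (b - 1) * (\sum_(p <= i < q) b ^+ i) = b ^+ q - b ^+ p.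
Proof.
move=> pq; rewrite mulr_sumr -(telescope_sumr (fun i => b ^+ i) pq).
by apply: eq_bigr => i _; rewrite exprS; ring.
Qed.

Lemma ln_near1_bound (R : realType) (x : R) : `|x - 1| <= 1 / 2 -> `|ln x| <= 2 * `|x - 1|.
Proof.
rewrite ler_norml => /andP[h1 h2]; have x0 : 0 < x by lra.
have up : ln x <= x - 1 by have := @le_ln1Dx R (x - 1); rewrite [1 + _]addrC subrK; apply; lra.
have dn : - ln x <= x^-1 - 1.
  have xi : 0 < x^-1 by rewrite invr_gt0.
  have := @le_ln1Dx R (x^-1 - 1); rewrite [1 + _]addrC subrK lnV ?posrE //; apply; lra.
have e : x^-1 - 1 = (1 - x) / x by field; rewrite gt_eqF.
have [x1|x1] := leP 1 x.
  by rewrite ger0_norm ?ln_ge0 // ger0_norm ?subr_ge0 //; lra.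
rewrite ler0_norm; last by rewrite ln_le0 // ltW.
rewrite ler0_norm ?opprB; last by lra.
apply: le_trans dn _; rewrite e ler_pdivrMr //; nra.
Qed.

(** Near 1, [|ln u| <= 2 |u - 1| <= 2 C / b ^+ k], so a lower bound for [|ln u|] limits [k]; away
    from 1 the bound on [|u - 1|] alone gives [b ^+ k <= 2 C]. *)
Lemma ln_lower_bound_exponent (R : realType) (b C T u : R) (k : nat) :
  1 < b -> 1 <= C -> 0 <= T -> `|u - 1| * b ^+ k <= C -> expR (- T) < `|ln u| ->
  k%:R * ln b <= T + ln (2 * C).
Proof.
move=> b1 C1 T0 huk hT; have b0 : 0 < b by apply: lt_trans b1.
have bk : 0 < b ^+ k by rewrite exprn_gt0.
have eT : 1 <= expR T by rewrite -expR0 ler_expR.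
have main : b ^+ k <= 2 * C * expR T.
  have [small|large] := leP `|u - 1| (1 / 2).
    have h1 := lt_le_trans hT (ln_near1_bound small).
    rewrite expRN in h1; have h2 : 1 < 2 * `|u - 1| * expR T.
      by rewrite -ltr_pdivrMr ?expR_gt0 // div1r.
    have h3 : b ^+ k <= 2 * `|u - 1| * expR T * b ^+ k by rewrite ler_peMl // ltW.
    apply: le_trans h3 _; have := expR_gt0 T; move: huk; set p := `|_|; set B := b ^+ k; set E := expR T.
    move=> h4 h5; have -> : 2 * p * E * B = 2 * (p * B) * E by ring.
    by rewrite ler_pM2r //; lra.
  have h1 : b ^+ k <= 2 * C by move: huk large bk; set p := `|_|; set B := b ^+ k; nra.
  by apply: le_trans h1 _; rewrite ler_peMr //; lra.
have C0 : 0 < 2 * C by lra.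
have -> : T + ln (2 * C) = ln (2 * C * expR T).
  by rewrite [ln (_ * expR _)]lnM ?posrE ?expR_gt0 // expRK addrC.
rewrite mulr_natl -lnXn // ler_ln ?posrE //.
by rewrite mulr_gt0 ?expR_gt0.
Qed.

Lemma real_equation_bounded (R : realType) (a b z c : R) (D : nat) :
  0 < a -> 1 < b -> 1 < z -> 0 <= c ->
  algebraicOver (ratr : rat -> R) a -> algebraicOver (ratr : rat -> R) b ->
  algebraicOver (ratr : rat -> R) z ->
  (forall i j i' j' : nat, z ^+ i * b ^+ j = z ^+ i' * b ^+ j' -> i = i' /\ j = j') ->
  (exists n0, forall n, (n0 <= n)%N -> forall (l M d : nat) (e : int),
     a * z ^+ n * (b - 1) <> (d%:R * b ^+ l - e%:~R) * b ^+ M) ->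
  exists B, forall l m n d1 d2, (1 <= l)%N -> (1 <= d1 <= D)%N -> (d2 <= D)%N ->
  `|a * z ^+ n - (d1%:R * (\sum_(l + m <= i < 2 * l + m) b ^+ i)
        + d2%:R * (\sum_(l <= i < l + m) b ^+ i)
        + d1%:R * (\sum_(0 <= i < l) b ^+ i))| <= c -> (n <= B)%N.
Proof.
move=> a0 b1 z1 c0 alga algb algz indep [n0 hn0].
have b0 : 0 < b by apply: lt_trans b1.
have z0 : 0 < z by apply: lt_trans z1.
have bb : 0 < b - 1 by rewrite subr_gt0.
have lnb : 0 < ln b by apply: ln_gt0.
have lnz : 0 < ln z by apply: ln_gt0.
have [T0 hT0] := affine_power_log_bound D a0 b1 z1 alga algb algz indep.
(* [C1] bounds what is left after removing one or both leading terms, in units of [b ^+ (l + m)] and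
   [b ^+ l] respectively. *)
pose C1 : R := c * (b - 1) + 3 * D%:R.
have C10 : 0 <= C1 by rewrite addr_ge0 ?mulr_ge0 // ltW.
(* The last summand serves the second form, whose affine factor is at least
   [b ^+ l * ((b - 1) / b)]. *)
pose C : R := 1 + C1 + C1 * (b / (b - 1)).
have C2 : 0 <= C1 * (b / (b - 1)) by rewrite mulr_ge0 // divr_ge0 // ltW.
have Cge1 : 1 <= C by rewrite /C; lra.
pose K := ln (2 * C); have K0 : 0 <= K by apply: ln_ge0; lra.
pose G1 := (Num.truncn ((1 + K) / ln b)).+1.
have hG1 (k : nat) (T : R) : 1 <= T -> k%:R * ln b <= T + K -> k%:R <= G1%:R * T.
  move=> T1 hk; have h1 : k%:R * ln b <= (1 + K) * T.
    apply: le_trans hk _; rewrite mulrDl mul1r lerD2l ler_peMr //.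
  have h2 : k%:R <= (1 + K) / ln b * T by rewrite mulrAC ler_pdivlMr.
  apply: le_trans h2 _; rewrite ler_wpM2r ?(le_trans ler01) // ltW //; exact: truncnS_gt.
pose w := ln ((D%:R + C1 + 1) / (a * (b - 1))).
pose G3 := (Num.truncn ((ln b + `|w|) / ln z)).+1.
(* The logarithmic bound is used at [t], giving [l <= G1 t^60], and then at [t^62], giving
   [l + m <= G1 t^(62 * 60)]; [62] leaves room for the constant [T0 * G1.+1 <= t]. *)
have [Ce hCe] := expR_beats_power (62 * 60) (G3%:R * (2 * G1%:R) * expR 1 + 1 : R).
pose Ts := (T0 + T0 * G1.+1 + (Num.truncn Ce).+1).+1.
exists (n0 + (Num.truncn (expR Ts%:R : R)).+1)%N => l m n d1 d2 l1 /andP[d11 d1D] d2D hyp.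
have [nn0|n0n] := leqP n n0; first by rewrite (leq_trans nn0) // leq_addr.
pose N := (2 * l + m)%N; pose e : int := d1%:Z - d2%:Z.
have eE : e%:~R = d1%:R - d2%:R :> R by rewrite rmorphB.
have eD : (`|e| <= D)%N by rewrite /e; move: d1D d2D; clear; lia.
have eR : `|e%:~R| <= D%:R :> R by rewrite -intr_norm -natr_absz ler_nat.
pose X := a * z ^+ n * (b - 1).
have X0 : 0 < X by rewrite !mulr_gt0 ?exprn_gt0.
have E1 : `|X - (d1%:R * b ^+ N - e%:~R * b ^+ (l + m) + e%:~R * b ^+ l - d1%:R)| <= c * (b - 1).
  have := hyp; rewrite -(ler_pM2r bb) -[X in _ * X <= _](gtr0_norm bb) -normrM.
  congr (`|_| <= _); rewrite mulrBl -/X; congr (_ - _).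
  rewrite mulrC 2!mulrDr !(mulrCA (b - 1)) !geometric_range //.
  - by rewrite eE expr0 /N; ring.
  - by rewrite leq_addr.
  - by move: l1; clear; lia.
have bge k : 1 <= b ^+ k by rewrite exprn_ege1 // ltW.
have bpos k : 0 < b ^+ k by rewrite exprn_gt0.
have D0 : 0 <= D%:R :> R by [].
have d1R : 1 <= d1%:R :> R by rewrite ler1n.
have d1DR : d1%:R <= D%:R :> R by rewrite ler_nat.
have d2R : 0 <= d2%:R :> R by [].
have bNE : b ^+ N = b ^+ l * b ^+ (l + m) by rewrite -exprD; congr (_ ^+ _); rewrite /N; clear; lia.
have blm : b ^+ l <= b ^+ (l + m) by rewrite ler_weXn2l ?leq_addr // ltW.
have step1 : `|X - d1%:R * b ^+ N| <= C1 * b ^+ (l + m).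
  have -> : X - d1%:R * b ^+ N = (X - (d1%:R * b ^+ N - e%:~R * b ^+ (l + m) + e%:~R * b ^+ l - d1%:R))
    + (- (e%:~R * b ^+ (l + m)) + e%:~R * b ^+ l - d1%:R) by ring.
  have h1 : `|e%:~R * b ^+ (l + m)| <= D%:R * b ^+ (l + m).
    by rewrite normrM (gtr0_norm (bpos _)) ler_pM2r.
  have h2 : `|e%:~R * b ^+ l| <= D%:R * b ^+ (l + m).
    by rewrite normrM (gtr0_norm (bpos _)) ler_pM // ltW.
  have h3 : d1%:R <= D%:R * b ^+ (l + m) by apply: le_trans d1DR _; rewrite ler_peMr.
  have h4 : c * (b - 1) <= c * (b - 1) * b ^+ (l + m) by rewrite ler_peMr // mulr_ge0 // ltW.
  apply: le_trans (ler_normD _ _) _; apply: le_trans (lerD E1 (ler_normB _ _)) _.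
  rewrite [`|d1%:R|]ger0_norm //.
  apply: le_trans (lerD h4 (lerD (ler_normD _ _) h3)) _; rewrite normrN.
  by rewrite /C1; lra.
have step2 : `|X - (d1%:R * b ^+ l - e%:~R) * b ^+ (l + m)| <= C1 * b ^+ l.
  have -> : X - (d1%:R * b ^+ l - e%:~R) * b ^+ (l + m) =
    (X - (d1%:R * b ^+ N - e%:~R * b ^+ (l + m) + e%:~R * b ^+ l - d1%:R))
    + (e%:~R * b ^+ l - d1%:R) by rewrite bNE; ring.
  have h2 : `|e%:~R * b ^+ l| <= D%:R * b ^+ l.
    by rewrite normrM (gtr0_norm (bpos _)) ler_pM2r.
  have h3 : d1%:R <= D%:R * b ^+ l by apply: le_trans d1DR _; rewrite ler_peMr.
  have h4 : c * (b - 1) <= c * (b - 1) * b ^+ l by rewrite ler_peMr // mulr_ge0 // ltW.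
  have h5 : 0 <= D%:R * b ^+ l by rewrite mulr_ge0 // ltW.
  apply: le_trans (ler_normD _ _) _; apply: le_trans (lerD E1 (ler_normB _ _)) _.
  rewrite [`|d1%:R|]ger0_norm //; apply: le_trans (lerD h4 (lerD h2 h3)) _.
  by rewrite /C1; lra.
have lnu y M : 0 < y -> ln ((a * (b - 1))^-1 * y) - n%:R * ln z + M%:R * ln b =
    - ln (X / (y * b ^+ M)).
  move=> y0; rewrite /X -!mulrA [z ^+ n * _]mulrC.
  rewrite !(lnM, lnV) ?posrE ?(mulr_gt0, invr_gt0, exprn_gt0) //.
  rewrite !lnXn // -[ln b *+ M]mulr_natl -[ln z *+ n]mulr_natl; ring.
have quot y M : 0 < y -> `|X / (y * b ^+ M) - 1| * (y * b ^+ M) = `|X - y * b ^+ M|.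
  move=> y0; have p0 : 0 < y * b ^+ M by rewrite mulr_gt0.
  by rewrite -[X in _ * X = _](gtr0_norm p0) -normrM mulrBl divfK ?gt_eqF // mul1r.
have N1 : (1 <= N)%N by rewrite /N; move: l1; clear; lia.
have G3N1 : (1 <= G3 * N)%N by rewrite muln_gt0.
have nN : (n <= G3 * N)%N.
  have h1 : X <= (D%:R + C1 + 1) * b ^+ N.
    have h2 : b ^+ (l + m) <= b ^+ N by rewrite bNE ler_peMl // ltW.
    have := step1; rewrite ler_norml => /andP[_ h3].
    have h4 : C1 * b ^+ (l + m) <= C1 * b ^+ N by rewrite ler_wpM2l.
    have h5 : d1%:R * b ^+ N <= D%:R * b ^+ N by rewrite ler_wpM2r // ltW.
    have := bpos N; lra.
  have DC : 0 < D%:R + C1 + 1 by rewrite ltr_wpDl // addr_ge0.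
  have h2 : n%:R * ln z <= w + N%:R * ln b.
    have -> : w + N%:R * ln b = ln ((D%:R + C1 + 1) / (a * (b - 1)) * b ^+ N).
      by rewrite [ln (_ * b ^+ N)]lnM ?posrE ?divr_gt0 ?mulr_gt0 // lnXn // -[ln b *+ N]mulr_natl.
    rewrite mulr_natl -lnXn // ler_ln ?posrE ?mulr_gt0 ?invr_gt0 ?mulr_gt0 ?exprn_gt0 //.
    by rewrite mulrAC ler_pdivlMr ?mulr_gt0 // mulrA [z ^+ n * a]mulrC.
  have h3 : n%:R * ln z <= (ln b + `|w|) * N%:R.
    apply: le_trans h2 _; rewrite mulrDl addrC [ln b * _]mulrC lerD2l.
    by apply: le_trans (ler_norm w) _; rewrite ler_peMr // ler1n.
  rewrite -(ler_nat R) natrM.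
  have h4 : n%:R <= (ln b + `|w|) / ln z * N%:R by rewrite mulrAC ler_pdivlMr.
  by apply: le_trans h4 _; rewrite ler_wpM2r // ltW //; exact: truncnS_gt.
pose s : R := ln (G3 * N)%:R.
have s0 : 0 <= s by apply: ln_ge0; rewrite ler1n.
have es : expR s = (G3 * N)%:R by rewrite lnK // posrE ltr0n.
(* [t] is about the logarithm of [G3 * N], so [expR t] bounds both [n] and [N]; a bounded [t]
   therefore bounds [n]. *)
pose t := (Num.truncn s).+1.
have st : s <= t%:R by apply: ltW; apply: truncnS_gt.
have ts : t%:R <= s + 1 by rewrite -natr1 lerD2r; case/andP: (truncn_itv s0).
have GNt : (G3 * N)%:R <= expR t%:R :> R by rewrite -es ler_expR.
have [tTs|Tst] := ltnP t Ts.
  have : (n%:R : R) < (Num.truncn (expR Ts%:R : R)).+1%:R.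
    apply: le_lt_trans (truncnS_gt _).
    apply: (@le_trans _ _ (G3 * N)%:R); first by rewrite ler_nat.
    by apply: le_trans GNt _; rewrite ler_expR ler_nat ltnW.
  by rewrite ltr_nat => h; rewrite (leq_trans (ltnW h)) // leq_addl.
exfalso.
have t1 : 1 <= t%:R :> R by rewrite ler1n.
have tT0 : (T0 <= t)%N.
  by apply: leq_trans Tst; rewrite /Ts leqW // -addnA leq_addr.
have tT1 : (T0 * G1.+1 <= t)%N.
  by apply: leq_trans Tst; rewrite /Ts leqW // addnAC leq_addl.
have tCe : Ce <= t%:R.
  apply: le_trans (ltW (truncnS_gt Ce)) _; rewrite ler_nat.
  by apply: leq_trans Tst; rewrite /Ts leqW // leq_addl.
have nt : n%:R <= expR t%:R :> R by apply: le_trans GNt; rewrite ler_nat.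
have Nt : N%:R <= expR t%:R :> R by apply: le_trans GNt; rewrite ler_nat leq_pmull.
have e01 : Num.min 1 (b - 1) <= d1%:R * b ^+ 0 - 0%:~R.
  by rewrite expr0 mulr1 subr0 ge_min d1R.
have d10 : 0 < d1%:R :> R by apply: lt_le_trans d1R.
(* First form: [l = 0], [e = 0], [M = N], with an error of order [b^-l]. *)
have lG : (l <= G1 * t ^ 60)%N.
  have := hT0 t 0%N N n d1 0 _ nt Nt d1D (leq0n _) e01 (hn0 n (ltnW n0n) _ _ _ _).
  rewrite muln1 => /(_ tT0); rewrite expr0 mulr1 subr0 lnu // normrN => h1.
  have h2 : `|X / (d1%:R * b ^+ N) - 1| * b ^+ l <= C.
    have := quot d1%:R N d10; have := step1; set p := `|_ / _ - 1|.
    move=> h3 h4; rewrite -h4 bNE in h3; have p0 : 0 <= p by apply: normr_ge0.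
    have h5 : p * b ^+ l * b ^+ (l + m) <= C1 * b ^+ (l + m).
      apply: le_trans h3; rewrite -!mulrA ler_wpM2l //.
      by rewrite ler_peMl // ltW // mulr_gt0.
    by rewrite ler_pM2r // in h5; rewrite /C; lra.
  have t60 : 1 <= t%:R ^+ 60 :> R by rewrite exprn_ege1.
  have := hG1 l _ t60 (ln_lower_bound_exponent b1 Cge1 (le_trans ler01 t60) h2 h1).
  by rewrite -natrX -natrM ler_nat.
pose y := d1%:R * b ^+ l - e%:~R.
(* By definition of [e], [y = d1 (b^l - 1) + d2]. *)
have yge : b ^+ l - 1 <= y.
  rewrite /y eE; have := bge l; nra.
have bl : b <= b ^+ l by rewrite -{1}[b]expr1 ler_weXn2l // ltW.
have e02 : Num.min 1 (b - 1) <= y.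
  by rewrite ge_min; apply/orP; right; lra.
have y0 : 0 < y by apply: lt_le_trans e02; rewrite lt_min ltr01.
have tt : t%:R <= (t ^ 62)%N%:R :> R by rewrite ler_nat -[X in (X <= _)%N]expn1 leq_pexp2l.
(* Second form, with an error of order [b^-(l+m)]. Its logarithmic height is of order [l.+1], now
   known to be [O(t^60)], so [t ^ 62] takes the place of [t]. *)
have lmG : (l + m <= G1 * (t ^ 62) ^ 60)%N.
  have lt : (T0 * l.+1 <= t ^ 62)%N.
    apply: (@leq_trans (T0 * G1.+1 * t ^ 60)%N).
      rewrite -mulnA leq_mul // mulSn; apply: leq_trans (leq_add (leqnn 1) lG) _.
      by rewrite leq_add2r expn_gt0.
    apply: leq_trans (leq_mul tT1 (leqnn _)) _.
    by rewrite -expnS leq_pexp2l.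
  have nt' : n%:R <= expR (t ^ 62)%N%:R :> R by apply: le_trans nt _; rewrite ler_expR.
  have lmt' : (l + m)%:R <= expR (t ^ 62)%N%:R :> R.
    apply: (@le_trans _ _ (N%:R)); first by rewrite ler_nat /N mul2n -addnn -addnA leq_addl.
    by apply: le_trans Nt _; rewrite ler_expR.
  have := hT0 (t ^ 62)%N l (l + m)%N n d1 e lt nt' lmt' d1D eD e02 (hn0 n (ltnW n0n) _ _ _ _).
  rewrite -/y lnu // normrN => h1.
  have h2 : `|X / (y * b ^+ (l + m)) - 1| * b ^+ (l + m) <= C.
    have := quot y (l + m)%N y0; have := step2; rewrite -/y; set p := `|_ / _ - 1|.
    move=> h3 h4; rewrite -h4 in h3.
    have p0 : 0 <= p by apply: normr_ge0.
    have yb : b ^+ l * ((b - 1) / b) <= y.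
      apply: le_trans yge; rewrite mulrA ler_pdivrMr //; nra.
    have h5 : p * b ^+ (l + m) * ((b - 1) / b) * b ^+ l <= C1 * b ^+ l.
      apply: le_trans h3.
      have -> : p * b ^+ (l + m) * ((b - 1) / b) * b ^+ l =
        p * ((b ^+ l * ((b - 1) / b)) * b ^+ (l + m)) by ring.
      by rewrite ler_wpM2l // ler_pM2r.
    rewrite ler_pM2r // in h5.
    have bb0 : 0 < (b - 1) / b by rewrite divr_gt0.
    rewrite -ler_pdivlMr // invf_div in h5; apply: le_trans h5 _.
    by rewrite /C; lra.
  have t60 : 1 <= (t ^ 62)%N%:R ^+ 60 :> R by rewrite exprn_ege1 // (le_trans t1).
  have := hG1 (l + m)%N _ t60 (ln_lower_bound_exponent b1 Cge1 (le_trans ler01 t60) h2 h1).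
  by rewrite -natrX -natrM ler_nat.
have hN : (G3 * N)%:R <= G3%:R * (2 * G1%:R) * t%:R ^+ (62 * 60) :> R.
  rewrite exprM -!natrX -!natrM ler_nat -!mulnA leq_mul //.
  apply: leq_trans (leq_mul (leqnn 2) lmG); rewrite /N mulnDr leq_add2l.
  by rewrite leq_pmull.
(* [expR t <= expR 1 * (G3 * N)] is at most a constant times [t ^ (62 * 60)], which contradicts
   [t >= Ce]. *)
have := hCe _ tCe; set P := t%:R ^+ _ in hN *.
have P1 : 1 <= P by rewrite exprn_ege1.
have h1 : expR t%:R <= expR s * expR 1 by rewrite -expRD ler_expR.
rewrite es in h1 => h2.
have := le_trans h2 (le_trans h1 (ler_wpM2r (expR_ge0 1) hN)).
rewrite mulrDl mul1r mulrAC; lra.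
Qed.

(** * From the complex equation to the real one *)

Local Open Scope classical_set_scope.
Local Open Scope ring_scope.

Lemma integral_image_algebraic (E : fieldExtType rat) (F : numFieldType)
    (iota : {rmorphism E -> F}) (x : E) :
  algebraic_integer x -> algebraicOver (ratr : rat -> F) (iota x).
Proof.
case=> p pmon px; exists (map_poly intr p); first by rewrite monic_neq0 // monic_map.
rewrite -map_poly_comp.
have -> : map_poly ((ratr : rat -> F) \o intr) p = map_poly iota (map_poly intr p).
  by rewrite -map_poly_comp; apply: eq_map_poly => i /=; rewrite ratr_int rmorph_int.
exact: rmorph_root.
Qed.

Lemma algebraic_real_complex (R : realType) (x : R) :
  algebraicOver (ratr : rat -> complex R) (real_complex R x) ->
  algebraicOver (ratr : rat -> R) x.
Proof.
case=> p p0 px; exists p => //; move: px.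
have -> : map_poly (ratr : rat -> complex R) p =
    map_poly (real_complex R) (map_poly ratr p).
  by rewrite -map_poly_comp; apply: eq_map_poly => q /=; rewrite fmorph_rat.
by rewrite fmorph_root.
Qed.

Lemma power_index_bounded (R : realType) (z k c : R) : 1 < z -> 0 < k ->
  exists B, forall n, k * z ^+ n <= c -> (n <= B)%N.
Proof.
move=> z1 k0; have z0 : 0 < z by apply: lt_trans z1.
have lz : 0 < ln z by apply: ln_gt0.
exists (Num.truncn (c / (k * ln z))).+1 => n h.
rewrite -(ler_nat R); apply: ltW; apply: le_lt_trans (truncnS_gt _).
rewrite ler_pdivlMr ?mulr_gt0 //; apply: le_trans h.
rewrite mulrCA ler_pM2l // -[z in z ^+ n](@lnK R) ?posrE // -expRM_natl.
by apply: le_trans (expR_ge1Dx _); rewrite lerDr.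
Qed.

Section Assembly.
Variables (R : realType) (K : fieldExtType rat) (iota : {rmorphism K -> complex R}).
Variables (beta : K) (f : {poly K}) (z1 z2 z3 : complex R) (b z : R).
Hypothesis f_int : forall i : nat, algebraic_integer f`_i.
Hypothesis f_roots : forall y : complex R,
  root (map_poly iota f) y <-> [\/ y = z1, y = z2 | y = z3].
Hypothesis z1_gt1 : 1 < z1.
Hypothesis z2_le1 : `|z2| <= 1.
Hypothesis z3_le1 : `|z3| <= 1.
Hypothesis z1_notinK : ~ exists x : K, iota x = z1.
Hypothesis betaE : iota beta = real_complex R b.
Hypothesis z1E : z1 = real_complex R z.
Hypothesis b_gt1 : 1 < b.
Hypothesis z_gt1 : 1 < z.

Lemma root_algebraic : algebraicOver (ratr : rat -> complex R) z1.
Proof.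
apply/integral_algebraic; apply: (@integral_root _ _ _ (map_poly iota f)).
(* [f] is not zero, as [z1 + 1] is no root: it differs from [z1] and its modulus exceeds 1. *)
- apply/negP => /eqP f0; have : root (map_poly iota f) (z1 + 1) by rewrite f0 root0.
  have n1 : 1 < `|z1 + 1|.
    have z10 : 0 < z1 by apply: lt_trans z1_gt1.
    by rewrite ger0_norm ?addr_ge0 ?(ltW z10) // (lt_trans z1_gt1) // ltrDl.
  move/f_roots => [/eqP|h|h].
  + by rewrite -subr_eq0 addrAC subrr add0r oner_eq0.
  + by move: n1; rewrite h => /lt_le_trans /(_ z2_le1); rewrite ltxx.
  + by move: n1; rewrite h => /lt_le_trans /(_ z3_le1); rewrite ltxx.
- by apply/f_roots; constructor 1.
- apply/integral_poly => i; rewrite coef_map /=; apply/integral_algebraic.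
  exact: integral_image_algebraic.
Qed.

Let notin a x : (0 < a)%N -> iota x <> z1 ^+ a.
Proof. exact: power_notin_base f_roots z1_gt1 z2_le1 z3_le1 z1_notinK a x. Qed.

Let real_power n : real_complex R (z ^+ n) = z1 ^+ n.
Proof. by rewrite rmorphXn z1E. Qed.

(** If [i < i'], the relation makes [z ^+ (i' - i)] a quotient of powers of [b], hence an element of
    [K], against [notin]; if [i = i'], then [b > 1] gives [j = j']. *)
Lemma powers_independent (i j i' j' : nat) :
  z ^+ i * b ^+ j = z ^+ i' * b ^+ j' -> i = i' /\ j = j'.
Proof.
have b0 : 0 < b by apply: lt_trans b_gt1.
have z0 : 0 < z by apply: lt_trans z_gt1.
have lt k k' l l' : (k < k')%N -> z ^+ k * b ^+ l <> z ^+ k' * b ^+ l'.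
  move=> kk' E; have d0 : (0 < k' - k)%N by rewrite subn_gt0.
  apply: (@notin (k' - k)%N (beta ^+ l / beta ^+ l') d0).
  rewrite fmorph_div !rmorphXn betaE -real_power -!rmorphXn -fmorph_div; congr (real_complex R _).
  apply: (mulfI (x := z ^+ k)); first by rewrite expf_neq0 // gt_eqF.
  rewrite mulrA E -exprD subnKC ?(ltnW kk') // mulfK // expf_neq0 // gt_eqF //.
move=> E; have [h|h|ii'] := ltngtP i i'; [by case: (lt _ _ _ _ h E) | by case: (lt _ _ _ _ h (esym E)) |].
split=> //; have b1 : b != 1 by rewrite gt_eqF.
have zi : z ^+ i' != 0 by rewrite expf_neq0 // gt_eqF.
by move: E; rewrite ii' => /(mulfI zi) /(ieexprIn b0 b1).
Qed.

(** The right-hand side lies in [K]. If [a z^n (b - 1)] lay in [K] for two values of [n], the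
    quotient would be a positive power of [z1] in [K]; so [n0] need only exceed one such [n]. *)
Lemma eventually_not_affine_power (a : R) : a != 0 ->
  exists n0, forall n, (n0 <= n)%N -> forall (l M d : nat) (e : int),
     a * z ^+ n * (b - 1) <> (d%:R * b ^+ l - e%:~R) * b ^+ M.
Proof.
move=> a0; pose P n := exists x : K, iota x = real_complex R (a * z ^+ n * (b - 1)).
have inK n l M d (e : int) : a * z ^+ n * (b - 1) = (d%:R * b ^+ l - e%:~R) * b ^+ M -> P n.
  move=> E; exists ((d%:R * beta ^+ l - e%:~R) * beta ^+ M); rewrite E.
  by rewrite !(rmorphM, rmorphB, rmorphXn, rmorph_nat, rmorph_int) betaE.
have [[n1 [x1 hx1]]|noP] := pselect (exists n, P n); last first.
  by exists 0%N => n _ l M d e E; apply: noP; exists n; apply: inK E.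
exists n1.+1 => n n1n l M d e /inK[x hx].
have d0 : (0 < n - n1)%N by rewrite subn_gt0.
apply: (@notin (n - n1)%N (x / x1) d0).
rewrite fmorph_div hx hx1 -fmorph_div -real_power; congr (real_complex R _).
have z0 : z != 0 by rewrite gt_eqF // (lt_trans ltr01).
have b1 : b - 1 != 0 by rewrite subr_eq0 gt_eqF.
rewrite -{1}(subnKC (ltnW n1n)) exprD; field.
by rewrite b1 a0 expf_neq0.
Qed.

(** The value in base [b] of the word of [l] digits [d1], [m] digits [d2] and again [l] digits
    [d1]. *)
Definition palindrome (l m d1 d2 : nat) : R :=
  d1%:R * (\sum_(l + m <= i < 2 * l + m) b ^+ i)
  + d2%:R * (\sum_(l <= i < l + m) b ^+ i)
  + d1%:R * (\sum_(0 <= i < l) b ^+ i).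

Lemma palindrome_ge0 l m d1 d2 : 0 <= palindrome l m d1 d2.
Proof.
have b0 : 0 <= b by apply: ltW; apply: lt_trans b_gt1.
by rewrite !addr_ge0 // mulr_ge0 // sumr_ge0 // => i _; rewrite exprn_ge0.
Qed.

(** The top digit alone suffices to bound [l] and [m] once [n] is bounded. *)
Lemma palindrome_ge l m d1 d2 : (1 <= l)%N -> (1 <= d1)%N ->
  b ^+ (2 * l + m).-1 <= palindrome l m d1 d2.
Proof.
move=> l1 d11; have b0 : 0 <= b by apply: ltW; apply: lt_trans b_gt1.
have s0 p q : 0 <= \sum_(p <= i < q) b ^+ i by rewrite sumr_ge0 // => i _; rewrite exprn_ge0.
have d0 (d : nat) : 0 <= d%:R :> R by [].
rewrite /palindrome -addrA; apply: ler_wpDr; first by rewrite addr_ge0 // mulr_ge0.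
have -> : (2 * l + m = (2 * l + m).-1.+1)%N by rewrite prednK // addn_gt0 muln_gt0 l1.
rewrite big_nat_recr /=; last by move: l1; clear; lia.
apply: (@le_trans _ _ (1 * (\sum_(l + m <= i < (2 * l + m).-1) b ^+ i + b ^+ (2 * l + m).-1))).
  by rewrite mul1r lerDr.
by rewrite ler_wpM2r ?addr_ge0 ?exprn_ge0 // ler1n.
Qed.

Lemma palindromeC l m d1 d2 : real_complex R (palindrome l m d1 d2) =
  d1%:R * (\sum_(l + m <= i < 2 * l + m) iota beta ^+ i)
  + d2%:R * (\sum_(l <= i < l + m) iota beta ^+ i)
  + d1%:R * (\sum_(0 <= i < l) iota beta ^+ i).
Proof.
have sumC p q : real_complex R (\sum_(p <= i < q) b ^+ i) = \sum_(p <= i < q) iota beta ^+ i.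
  by rewrite rmorph_sum betaE; apply: eq_bigr => i _; rewrite rmorphXn.
by rewrite -!sumC /palindrome !rmorphD !rmorphM !rmorph_nat.
Qed.

Variables (A1 A2 A3 : complex R) (D : nat).
Hypothesis beta_int : algebraic_integer beta.
Hypothesis A1_alg : algebraicOver (ratr : rat -> complex R) A1.
Hypothesis A1_neq0 : A1 <> 0.

(** Norms in [complex R] are themselves complex, so the bound for the two minor terms is brought
    back to [R] by its real part. *)
Let c := complex.Re (`|A2| + `|A3|).
Let cE : real_complex R c = `|A2| + `|A3|.
Proof. by apply: RRe_real; rewrite realD ?normr_real. Qed.

Let tail_bound n x : A1 * z1 ^+ n + A2 * z2 ^+ n + A3 * z3 ^+ n = x ->
  `|A1 * z1 ^+ n - x| <= real_complex R c.
Proof.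
move=> <-; have -> : A1 * z1 ^+ n - (A1 * z1 ^+ n + A2 * z2 ^+ n + A3 * z3 ^+ n) =
  - (A2 * z2 ^+ n + A3 * z3 ^+ n) by ring.
rewrite normrN cE (le_trans (ler_normD _ _)) // !normrM !normrX.
by rewrite lerD // ler_piMr // exprn_ile1.
Qed.

Let part_bound n l m d1 d2 :
  A1 * z1 ^+ n + A2 * z2 ^+ n + A3 * z3 ^+ n = real_complex R (palindrome l m d1 d2) ->
  `|complex.Re A1 * z ^+ n - palindrome l m d1 d2| <= c /\ `|complex.Im A1| * z ^+ n <= c.
Proof.
move=> /tail_bound; rewrite -real_power.
set x := A1 * _ - _ => hx.
have xE : x = Complex (complex.Re A1 * z ^+ n - palindrome l m d1 d2) (complex.Im A1 * z ^+ n).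
  by rewrite /x; case: A1 => a1 a2; apply/eqP; rewrite eq_complex /=; apply/andP; split; apply/eqP; ring.
split.
  rewrite -lecR; apply: le_trans hx; apply: le_trans (normc_ge_Re x).
  by rewrite xE /=.
have zn : 0 <= z ^+ n by rewrite exprn_ge0 // ltW // (lt_trans ltr01).
rewrite -lecR; apply: le_trans hx.
(* Multiplication by the imaginary unit turns the imaginary part into a real part, up to sign,
   without changing the modulus. *)
have -> : `|x| = `|x * Complex 0 1|.
  rewrite normrM [X in _ * X](_ : _ = 1) ?mulr1 // normc_def /=.
  by rewrite expr0n add0r expr1n sqrtr1.
apply: le_trans (normc_ge_Re _); rewrite ReiNIm normrN xE /= lecR.
by rewrite normrM (ger0_norm zn).
Qed.

(** The right-hand side is real and nonnegative, so an [A1] with nonzero imaginary part or negative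
    real part bounds [z ^+ n] at once; a positive real [A1] leaves the real equation. *)
Lemma solution_index_bounded : exists B, forall l m n d1 d2,
  (1 <= l)%N -> (1 <= d1 <= D)%N -> (d2 <= D)%N ->
  A1 * z1 ^+ n + A2 * z2 ^+ n + A3 * z3 ^+ n = real_complex R (palindrome l m d1 d2) ->
  (n <= B)%N.
Proof.
have zn n : 0 <= z ^+ n by rewrite exprn_ge0 // ltW // (lt_trans ltr01).
have [im0|im0] := eqVneq (complex.Im A1) 0; last first.
  have [|B hB] := @power_index_bounded R z `|complex.Im A1| c z_gt1; first by rewrite normr_gt0.
  by exists B => l m n d1 d2 _ _ _ /part_bound[_ /hB].
have A1E : A1 = real_complex R (complex.Re A1) by rewrite {1}[A1]complexE im0 mulr0 addr0.
have [re0|re0|re0] := ltrgtP (complex.Re A1) 0.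
- have [|B hB] := @power_index_bounded R z (- complex.Re A1) c z_gt1; first by rewrite oppr_gt0.
  exists B => l m n d1 d2 _ _ _ /part_bound[h _]; apply: hB; move: h.
  rewrite ler_norml => /andP[h _]; have := palindrome_ge0 l m d1 d2; lra.
- have c0 : 0 <= c by rewrite -ler0c cE addr_ge0.
  have alga : algebraicOver (ratr : rat -> R) (complex.Re A1).
    by apply: algebraic_real_complex; rewrite -A1E.
  have algb : algebraicOver (ratr : rat -> R) b.
    by apply: algebraic_real_complex; rewrite -betaE; apply: integral_image_algebraic.
  have algz : algebraicOver (ratr : rat -> R) z.
    by apply: algebraic_real_complex; rewrite -z1E; apply: root_algebraic.
  have n0 := eventually_not_affine_power (lt0r_neq0 re0).
  have [B hB] := real_equation_bounded D re0 b_gt1 z_gt1 c0 alga algb algz powers_independent n0.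
  by exists B => l m n d1 d2 l1 d11 d2D /part_bound[h _]; apply: (hB l m n d1 d2).
- by case: A1_neq0; rewrite A1E re0.
Qed.

Lemma solution_bounded : exists B, forall l m n d1 d2,
  (1 <= l)%N -> (1 <= d1 <= D)%N -> (d2 <= D)%N ->
  A1 * z1 ^+ n + A2 * z2 ^+ n + A3 * z3 ^+ n = real_complex R (palindrome l m d1 d2) ->
  [/\ (l < B)%N, (m < B)%N, (n < B)%N, (d1 < B)%N & (d2 < B)%N].
Proof.
have [B1 hB1] := solution_index_bounded.
have b0 : 0 < b by apply: lt_trans b_gt1.
(* For [n <= B1] this constant bounds the palindrome, hence its top power of [b]. *)
have [B2 hB2] := @power_index_bounded R b 1 (`|complex.Re A1| * z ^+ B1 + c) b_gt1 ltr01.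
exists (B1 + B2 + D).+2 => l m n d1 d2 l1 /andP[d11 d1D] d2D E.
have nB : (n <= B1)%N by apply: (hB1 l m n d1 d2); rewrite // d11.
have [h _] := part_bound E.
have k : ((2 * l + m).-1 <= B2)%N.
  apply: hB2; rewrite mul1r; apply: le_trans (palindrome_ge m d2 l1 d11) _.
  have h1 : complex.Re A1 * z ^+ n <= `|complex.Re A1| * z ^+ B1.
    apply: le_trans (ler_norm _) _; rewrite normrM ler_wpM2l // ger0_norm.
      by rewrite ler_weXn2l // ltW.
    by rewrite exprn_ge0 // ltW // (lt_trans ltr01).
  move: h; rewrite ler_norml => /andP[h _]; lra.
move: nB d1D d2D k; clear; move=> *; split; lia.
Qed.

End Assembly.

Theorem theorem1p1
  (R : realType)
  (K : fieldExtType rat) (iota : {rmorphism K -> complex R})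
  (beta : K)
  (beta_int : algebraic_integer beta)
  (beta_real : iota beta \is Num.real)
  (beta_gt1 : 1 < iota beta)
  (norm_gt1 : 1 < `|field_norm beta|)
  (f : {poly K})
  (f_int : forall i : nat, algebraic_integer f`_i)
  (z1 z2 z3 : complex R)
  (f_roots : forall z : complex R,
     root (map_poly iota f) z <-> [\/ z = z1, z = z2 | z = z3])
  (z12 : z1 <> z2) (z13 : z1 <> z3) (z23 : z2 <> z3)
  (z1_real : z1 \is Num.real)
  (z1_gt1 : 1 < z1)
  (z2_le1 : `|z2| <= 1)
  (z3_le1 : `|z3| <= 1)
  (A1 A2 A3 : complex R)
  (A1_alg : algebraicOver (ratr : rat -> complex R) A1)
  (A2_alg : algebraicOver (ratr : rat -> complex R) A2)
  (A3_alg : algebraicOver (ratr : rat -> complex R) A3)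
  (A1_neq0 : A1 <> 0)
  (z1_notinK : ~ exists x : K, iota x = z1) :
  finite_set [set t : nat * nat * nat * nat * nat |
    let: (l, m, n, d1, d2) := t in
    [/\ [/\ (1 <= l)%N, (1 <= m)%N & (1 <= n)%N],
        (1 <= d1)%N /\ d1%:R <= `|field_norm beta| - 1,
        d2%:R <= `|field_norm beta| - 1
      & A1 * z1 ^+ n + A2 * z2 ^+ n + A3 * z3 ^+ n =
        d1%:R * (\sum_(l + m <= i < 2 * l + m) iota beta ^+ i)
        + d2%:R * (\sum_(l <= i < l + m) iota beta ^+ i)
        + d1%:R * (\sum_(0 <= i < l) iota beta ^+ i) ] ].
Proof.
have [b betaE] := complex_realP _ beta_real.
have [z z1E] := complex_realP _ z1_real.
have b1 : 1 < b by move: beta_gt1; rewrite betaE -(rmorph1 (real_complex R)) ltcR.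
have z_1 : 1 < z by move: z1_gt1; rewrite z1E -(rmorph1 (real_complex R)) ltcR.
(* The norm has type [rat], whereas the digits need a bound in [nat]. *)
pose D := Num.truncn `|field_norm beta|.
have digit (d : nat) : d%:R <= `|field_norm beta| - 1 -> (d <= D)%N.
  move=> h; rewrite -ltnS -(ltr_nat rat); apply: le_lt_trans h _.
  by apply: le_lt_trans (truncnS_gt _); rewrite lerBlDr lerDl.
have [B hB] := solution_bounded f_int f_roots z1_gt1 z2_le1 z3_le1 z1_notinK betaE z1E
  b1 z_1 A2 A3 D beta_int A1_alg A1_neq0.
apply: (@sub_finite_set _ _ (`I_B `*` `I_B `*` `I_B `*` `I_B `*` `I_B)); last first.
  by do !apply: finite_setX; apply: finite_II.
move=> [[[[l m] n] d1] d2] [[l1 _ _] [d11 /digit d1D] /digit d2D E] /=.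
have [//||? ? ? ? ?] := hB l m n d1 d2 l1 _ d2D; first by rewrite d11.
- by rewrite (palindromeC betaE).
- by [].
Qed.
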